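(* If the Strong Exponential Time Hypothesis holds, then for every prime power $q$ and every rational $\delta>0$ there exists $d\in\mathbb{N}$ such that there is no algorithm solving $\mathrm{PES}_{q,d}$ in time $\mathcal{O}^\ast(q^{(1-\delta)n})$, where $n$ is the number of variables.
   Context: For a prime power $q$ and positive integer $d$, the problem $\mathrm{PES}_{q,d}$ is: given polynomials $P_1,\dots,P_m\in\mathbb{F}_q[X_1,\dots,X_n]$, each of total degree at most $d$ and given explicitly as a list of monomial–coefficient pairs, decide whether there is $x\in\mathbb{F}_q^n$ with $P_1(x)=\dots=P_m(x)=0$. $\mathcal{O}^\ast(\cdot)$ hides factors polynomial in the input size. The Strong Exponential Time Hypothesis (SETH) states: for every $\varepsilon>0$ there is some $k\geq 3$ such that $k$-SAT on $n$ variables cannot be solved in time $\mathcal{O}(2^{(1-\varepsilon)n})$. *)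

(* Defs.v *)
From Stdlib Require Import Reals QArith Qreals.
From mathcomp Require Import all_boot all_order all_algebra.
From mathcomp.multinomials Require Import mpoly.

Set Implicit Arguments.
Unset Strict Implicit.
Unset Printing Implicit Defensive.

(* The key %R denotes ring_scope from here on. *)
Delimit Scope R_scope with real.
Local Open Scope nat_scope.

(** * Machine model: logarithmic-cost RAM

    A RAM with registers r_0, r_1, ... (a program mentions only finitely many
    of them, each by a fixed name) and a word-addressable memory.  Words are
    natural numbers of unbounded size; as in Cook and Reckhow's RAM, an
    instruction is charged the bit length of the operands it handles, including
    addresses, and the only arithmetic is addition and (truncated)
    subtraction. *)

Inductive prog : Type :=
  | Skip
  | Const of nat & nat          (* Const x c   : r_x := c         *)
  | Add of nat & nat & nat      (* Add x y z   : r_x := r_y + r_z *)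
  | Sub of nat & nat & nat      (* Sub x y z   : r_x := r_y - r_z *)
  | Get of nat & nat            (* Get x y     : r_x := M[r_y]    *)
  | Put of nat & nat            (* Put x y     : M[r_x] := r_y    *)
  | Seq of prog & prog
  | If of nat & prog & prog     (* tests r_x <> 0 *)
  | While of nat & prog.        (* tests r_x <> 0 *)

Record state : Type := State { reg : nat -> nat; mem : nat -> nat }.

Definition update (f : nat -> nat) (i v : nat) : nat -> nat :=
  fun j => if j == i then v else f j.

Definition set_reg (s : state) (x v : nat) : state :=
  State (update (reg s) x v) (mem s).

Definition set_mem (s : state) (a v : nat) : state :=
  State (reg s) (update (mem s) a v).

Definition bitlen (a : nat) : nat := up_log 2 a.+1.

(** [exec c s t s']: started in [s], the program [c] halts in [s'] after
    time [t]. *)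
Inductive exec : prog -> state -> nat -> state -> Prop :=
  | ExecSkip s : exec Skip s 1 s
  | ExecConst s x c :
      exec (Const x c) s (bitlen c).+1 (set_reg s x c)
  | ExecAdd s x y z :
      exec (Add x y z) s (bitlen (reg s y) + bitlen (reg s z)).+1
           (set_reg s x (reg s y + reg s z))
  | ExecSub s x y z :
      exec (Sub x y z) s (bitlen (reg s y) + bitlen (reg s z)).+1
           (set_reg s x (reg s y - reg s z))
  | ExecGet s x y :
      exec (Get x y) s (bitlen (reg s y) + bitlen (mem s (reg s y))).+1
           (set_reg s x (mem s (reg s y)))
  | ExecPut s x y :
      exec (Put x y) s (bitlen (reg s x) + bitlen (reg s y)).+1
           (set_mem s (reg s x) (reg s y))
  | ExecSeq c1 c2 s1 s2 s3 t1 t2 :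
      exec c1 s1 t1 s2 -> exec c2 s2 t2 s3 ->
      exec (Seq c1 c2) s1 (t1 + t2) s3
  | ExecIfTrue x c1 c2 s s' t :
      reg s x <> 0 -> exec c1 s t s' ->
      exec (If x c1 c2) s ((bitlen (reg s x)).+1 + t) s'
  | ExecIfFalse x c1 c2 s s' t :
      reg s x = 0 -> exec c2 s t s' ->
      exec (If x c1 c2) s ((bitlen (reg s x)).+1 + t) s'
  | ExecWhileTrue x c s1 s2 s3 t1 t2 :
      reg s1 x <> 0 -> exec c s1 t1 s2 -> exec (While x c) s2 t2 s3 ->
      exec (While x c) s1 ((bitlen (reg s1 x)).+1 + t1 + t2) s3
  | ExecWhileFalse x c s :
      reg s x = 0 -> exec (While x c) s (bitlen (reg s x)).+1 s.

(** The input word [w] occupies memory cells 0, ..., size w - 1, its length is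
    in register 0, and everything else is 0. *)
Definition init_state (w : seq nat) : state :=
  State (update (fun _ => 0) 0 (size w)) (fun a => nth 0 w a).

(** One extra unit per entry accounts for a separator (and makes the entry 0
    count). *)
Definition input_size (w : seq nat) : nat := sumn [seq (bitlen a).+1 | a <- w].

(** * Decision problems *)

(** An instance may have several encodings (a set can be listed in any order);
    an algorithm has to be correct on all of them. *)
Record problem : Type := Problem {
  instance : Type;
  nvars : instance -> nat;
  encodes : instance -> seq nat -> Prop;
  yes : instance -> Prop
}.

Definition solves_in_time (P : problem) (c : prog)
    (bound : instance P -> seq nat -> R) : Prop :=
  forall (I : instance P) (w : seq nat), encodes I w ->
  exists (t : nat) (s : state),
    [/\ exec c (init_state w) t s,
        reg s 0 <> 0 <-> yes I
      & (INR t <= bound I w)%real].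

(** Time O(b^(a n)), with n the number of variables. *)
Definition solvable_in_O_exp (P : problem) (b a : R) : Prop :=
  exists (c : prog) (K : R),
    @solves_in_time P c (fun I _ =>
      (K * Rpower b (a * INR (nvars I)))%real).

(** Time O^*(b^(a n)). *)
Definition solvable_in_Ostar_exp (P : problem) (b a : R) : Prop :=
  exists (c : prog) (K : R) (e : nat),
    @solves_in_time P c (fun I w =>
      (K * Rpower b (a * INR (nvars I)) * INR (input_size w) ^ e)%real).

(** * k-SAT and SETH *)

(** [(v, true)] is the literal v, [(v, false)] its negation. *)
Notation literal n := ('I_n * bool)%type.

(** Formulas are sets of clauses.  Since a clause cannot be repeated, the size
    of a k-CNF formula is polynomial in n for fixed k, which is what makes a running time
    bounded in terms of n alone a meaningful requirement. *)
Record kcnf (k : nat) : Type := KCNF {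
  kcnf_vars : nat;
  kcnf_clauses : {set {set literal kcnf_vars}};
  kcnf_width : forall C, C \in kcnf_clauses -> #|C| <= k
}.

Definition satisfiable (k : nat) (f : kcnf k) : Prop :=
  exists a : 'I_(kcnf_vars f) -> bool,
    forall C, C \in kcnf_clauses f ->
      exists2 l : literal (kcnf_vars f), l \in C & a l.1 = l.2.

Definition literal_code (n : nat) (l : literal n) : nat := (l.1).*2 + l.2.

Definition kcnf_encodes (k : nat) (f : kcnf k) (w : seq nat) : Prop :=
  exists cs : seq (seq (literal (kcnf_vars f))),
    [/\ all uniq cs,
        perm_eq [seq [set l in c] | c <- cs] (enum (kcnf_clauses f))
      & w = [:: kcnf_vars f, size cs
              & flatten [seq size c :: map (@literal_code _) c | c <- cs]]].

Definition kSAT (k : nat) : problem :=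
  Problem (@kcnf_vars k) (@kcnf_encodes k) (@satisfiable k).

Definition SETH : Prop :=
  forall eps : R, (0 < eps)%real ->
  exists2 k : nat, 3 <= k &
    ~ solvable_in_O_exp (kSAT k) 2%real (1 - eps)%real.

(** * Polynomial equation systems *)

Definition prime_power (q : nat) : Prop :=
  exists p e : nat, [/\ prime p, 0 < e & q = p ^ e].

Record polysys (F : finFieldType) (d : nat) : Type := PolySys {
  ps_vars : nat;
  ps_polys : seq {mpoly F[ps_vars]};
  (* [msize p] is 1 + the total degree of p, and 0 for p = 0 *)
  ps_degree : forall p, p \in ps_polys -> msize p <= d.+1
}.

Definition has_common_zero (F : finFieldType) (d : nat) (S : polysys F d) :
    Prop :=
  exists x : 'I_(ps_vars S) -> F,
    forall p, p \in ps_polys S -> (p.@[x] = 0)%R.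

(** [l] lists, in some order, the monomials of [p] with their (nonzero)
    coefficients. *)
Definition lists_poly (F : finFieldType) (n : nat)
    (l : seq ('X_{1..n} * F)) (p : {mpoly F[n]}) : bool :=
  perm_eq l [seq (m, (p@_m)%R) | m <- msupp p].

(** A coefficient is written as its rank in 0, ..., #|F| - 1 under a fixed
    enumeration of F, a monomial as the vector of its n exponents. *)
Definition term_code (F : finFieldType) (n : nat) (t : 'X_{1..n} * F) :
    seq nat :=
  nat_of_ord (enum_rank t.2) :: [seq t.1 i | i <- enum 'I_n].

Definition polysys_encodes (F : finFieldType) (d : nat) (S : polysys F d)
    (w : seq nat) : Prop :=
  exists ls : seq (seq ('X_{1..ps_vars S} * F)),
    all2 (@lists_poly F (ps_vars S)) ls (ps_polys S) /\
    w = [:: ps_vars S, size ls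
          & flatten [seq size l :: flatten (map (@term_code F _) l)
                    | l <- ls]].

Definition PES (F : finFieldType) (d : nat) : problem :=
  Problem (@ps_vars F d) (@polysys_encodes F d) (@has_common_zero F d).

(* Main.v *)
Require Import Defs.
From Stdlib Require Import Reals QArith Qreals.
From Stdlib Require Import Lra FunctionalExtensionality.
From mathcomp Require Import all_boot all_algebra.
From mathcomp Require Import all_field.
From mathcomp.multinomials Require Import mpoly.
From mathcomp Require Import zify.

Set Implicit Arguments.
Unset Strict Implicit.
Unset Printing Implicit Defensive.
Import GRing.Theory.
Local Open Scope nat_scope.

(** Split the Boolean variables of a k-CNF formula into blocks of [s] bits and
    encode a block by [r] elements of F_q through a surjection of F_q^r onto
    {0,1}^s, where [s] is maximal with 2^s <= q^r.  This uses at most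
    (n / s + 1) r variables, and for r large q^((1 - delta) (n / s + 1) r) is
    O(2^((1 - delta/2) n)).  That a literal is false is a function on F_q^r,
    hence a polynomial of degree at most r (q - 1), and a clause becomes the
    equation that the product of these polynomials over its literals vanishes;
    its degree depends only on q, r and k.  Substituting x^(D^i) for x in the
    i-th factor, with D a large power of q, does not change the function and
    makes all monomials of the expanded product distinct, so a RAM can write
    the product down from finite tables, without collecting terms.  It runs in
    polynomial time, and the polynomial overhead is absorbed into the
    exponential. *)

(** * Weakest preconditions for the RAM *)

(** A solver for polynomial systems is only known to run from states of the form [init_state]. The
    reduction must therefore end exactly in such a state, with its output moved to address 0 and all
    scratch cells and registers zeroed; only then does [Seq] compose it with the solver. Under
    logarithmic cost a count of steps gives a running time only together with a bound on the length
    of all words, so [weight] bounds both at once. The encoding of a system lists distinct monomials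
    with nonzero coefficients. Expanding a product term by term would break this as soon as two
    literals of a clause share a block; this is the obstacle that the powers of D remove. The order
    of choices matters: [r] and [s] depend on q and delta alone, SETH then supplies [k] for a saving
    fixed by delta, and the degree may depend on all of them. *)

Fixpoint wloop (x : nat) (body : (state -> Prop) -> state -> Prop)
    (Q : state -> Prop) (n : nat) (s : state) : Prop :=
  if reg s x == 0 then Q s
  else if n is n'.+1 then body (wloop x body Q n') s else False.

(* Weakest precondition for halting in [Q] when every loop, each time it is
   entered, makes at most [B] iterations. *)
Fixpoint wp (B : nat) (c : prog) (Q : state -> Prop) (s : state) : Prop :=
  match c with
  | Skip => Q s
  | Const x v => Q (set_reg s x v)
  | Add x y z => Q (set_reg s x (reg s y + reg s z))
  | Defs.Sub x y z => Q (set_reg s x (reg s y - reg s z))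
  | Get x y => Q (set_reg s x (Defs.mem s (reg s y)))
  | Put x y => Q (set_mem s (reg s x) (reg s y))
  | Seq c1 c2 => wp B c1 (wp B c2 Q) s
  | If x c1 c2 => if reg s x == 0 then wp B c2 Q s else wp B c1 Q s
  | While x c => exists2 n, n <= B & wloop x (wp B c) Q n s
  end.

Fixpoint weight (B : nat) (c : prog) : nat :=
  match c with
  | Const _ v => (bitlen v).+1
  | Seq c1 c2 => weight B c1 + weight B c2
  | If _ c1 c2 => (weight B c1 + weight B c2).+1
  | While _ c => (B * (weight B c).+1).+1
  | _ => 1
  end.

Fixpoint reg_bound (c : prog) : nat :=
  match c with
  | Const x _ | Add x _ _ | Defs.Sub x _ _ | Get x _ => x.+1
  | Seq c1 c2 | If _ c1 c2 => maxn (reg_bound c1) (reg_bound c2)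
  | While _ c => reg_bound c
  | _ => 0
  end.

Definition bitlen_within (b : nat) (s : state) : Prop :=
  (forall x, bitlen (reg s x) <= b) /\ (forall a, bitlen (Defs.mem s a) <= b).

Lemma leq_bitlen m n : m <= n -> bitlen m <= bitlen n.
Proof. by move=> mn; apply: leq_up_log. Qed.

Lemma bitlen_leq n : bitlen n <= n.
Proof.
rewrite /bitlen; apply: leq_trans (up_log_min (ltnSn 1) (ltn_expl n (ltnSn 1))) _.
by [].
Qed.

Lemma bitlenD m n b : bitlen m <= b -> bitlen n <= b -> bitlen (m + n) <= b.+1.
Proof.
move=> hm hn; apply: up_log_min => //.
have le x : bitlen x <= b -> x.+1 <= 2 ^ b.
  move=> hx; apply: leq_trans (up_logP x.+1 (ltnSn 1)) _.
  by rewrite leq_exp2l.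
by move: (le _ hm) (le _ hn); rewrite expnS; lia.
Qed.

Lemma bitlen_within_le b b' s : b <= b' -> bitlen_within b s -> bitlen_within b' s.
Proof. by move=> le [h1 h2]; split=> a; apply: leq_trans le. Qed.

Lemma bitlen_within_set_reg b s x v :
  bitlen v <= b -> bitlen_within b s -> bitlen_within b (set_reg s x v).
Proof. by move=> hv [h1 h2]; split=> //= y; rewrite /update; case: eqP. Qed.

Lemma bitlen_within_set_mem b s a v :
  bitlen v <= b -> bitlen_within b s -> bitlen_within b (set_mem s a v).
Proof. by move=> hv [h1 h2]; split=> //= y; rewrite /update; case: eqP. Qed.

(** The last clause is what makes it possible to restore an initial state: registers from [rb] on
    keep their value, so finitely many have to be cleared. *)
Definition runs_within (c : prog) (b W rb : nat) (Q : state -> Prop)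
    (s : state) : Prop :=
  exists t s', [/\ exec c s t s', Q s', t <= W * (2 * (b + W)).+1,
    bitlen_within (b + W) s' & forall z, rb <= z -> reg s' z = reg s z].

(** An addition lengthens the longest word by at most one bit and a constant [v] brings in at most
    [bitlen v] bits, so words stay within [b + W] bits when [W] is the weight. Each unit of weight
    then pays for at most [2 * (b + W) + 1] units of time. *)
Lemma wp_sound B c Q s b :
  bitlen_within b s -> wp B c Q s ->
  runs_within c b (weight B c) (reg_bound c) Q s.
Proof.
elim: c Q s b => [|x v|x y z|x y z|x y|x y|c1 IH1 c2 IH2|x c1 IH1 c2 IH2|x c IH]
  Q s b bs /=.
- exists 1, s; split=> //; first exact: ExecSkip.
  by apply: bitlen_within_le bs; lia.
- exists (bitlen v).+1, (set_reg s x v); split=> //; [exact: ExecConst | exact: leq_pmulr | |].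
    by apply: bitlen_within_set_reg; [lia | apply: bitlen_within_le bs; lia].
  by move=> z hz /=; rewrite /update; case: eqP => // ?; lia.
- have [h1 h2] := bs; have := h1 y; have := h1 z => hz hy.
  exists (bitlen (reg s y) + bitlen (reg s z)).+1, (set_reg s x (reg s y + reg s z)).
  split=> //; [exact: ExecAdd | rewrite mul1n; lia | |].
    apply: bitlen_within_set_reg; last by apply: bitlen_within_le bs; lia.
    by rewrite addn1; apply: bitlenD.
  by move=> u hu /=; rewrite /update; case: eqP => // ?; lia.
- have [h1 h2] := bs; have := h1 y; have := h1 z => hz hy.
  exists (bitlen (reg s y) + bitlen (reg s z)).+1, (set_reg s x (reg s y - reg s z)).
  split=> //; [exact: ExecSub | rewrite mul1n; lia | |].
    apply: bitlen_within_set_reg; last by apply: bitlen_within_le bs; lia.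
    by have := leq_bitlen (leq_subr (reg s z) (reg s y)); lia.
  by move=> u hu /=; rewrite /update; case: eqP => // ?; lia.
- have [h1 h2] := bs; have := h1 y; have := h2 (reg s y) => hz hy.
  exists (bitlen (reg s y) + bitlen (Defs.mem s (reg s y))).+1,
    (set_reg s x (Defs.mem s (reg s y))).
  split=> //; [exact: ExecGet | rewrite mul1n; lia | |].
    by apply: bitlen_within_set_reg; [lia | apply: bitlen_within_le bs; lia].
  by move=> u hu /=; rewrite /update; case: eqP => // ?; lia.
- have [h1 h2] := bs; have := h1 y; have := h1 x => hz hy.
  exists (bitlen (reg s x) + bitlen (reg s y)).+1, (set_mem s (reg s x) (reg s y)).
  split=> //; [exact: ExecPut | rewrite mul1n; lia |].
  by apply: bitlen_within_set_mem; [lia | apply: bitlen_within_le bs; lia].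
- move=> /(IH1 _ _ _ bs) [t1 [s1 [e1 /IH2 h t1le b1 f1]]].
  have [t2 [s2 [e2 q2 t2le b2 f2]]] := h _ b1.
  exists (t1 + t2), s2; split=> //; [exact: ExecSeq e1 e2 | nia | |].
    by apply: bitlen_within_le b2; lia.
  by move=> z hz; rewrite f2 ?f1 //; lia.
- have [h1 _] := bs; have hx := h1 x.
  case: eqP => x0 w.
    have [t [s' [e q tle b' f]]] := IH2 _ _ _ bs w.
    exists ((bitlen (reg s x)).+1 + t), s'; split=> //.
    + exact: ExecIfFalse.
    + nia.
    + by apply: bitlen_within_le b'; lia.
    + by move=> z hz; rewrite f //; lia.
  have [t [s' [e q tle b' f]]] := IH1 _ _ _ bs w.
  exists ((bitlen (reg s x)).+1 + t), s'; split=> //.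
  + exact: ExecIfTrue.
  + nia.
  + by apply: bitlen_within_le b'; lia.
  + by move=> z hz; rewrite f //; lia.
- case=> n nB w.
  (* The inner induction needs a bound that shrinks with the remaining iterations [n]; [n <= B] is
     used only to pass to the weight. *)
  suff: runs_within (While x c) b (n * (weight B c).+1).+1 (reg_bound c) Q s.
    have le : n * (weight B c).+1 <= B * (weight B c).+1 by rewrite leq_mul2r nB orbT.
    case=> t [s' [e q tle b' f]]; exists t, s'; split=> //.
      by apply: leq_trans tle _; apply: leq_mul; lia.
    by apply: bitlen_within_le b'; lia.
  elim: n s b bs w {nB} => [|n IHn] s b bs /=; have [h1 _] := bs; have hx := h1 x.
    case: eqP => // x0 q; exists (bitlen (reg s x)).+1, s; split=> //.
    + exact: ExecWhileFalse.
    + nia.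
    + by apply: bitlen_within_le bs; lia.
  case: eqP => x0 w.
    exists (bitlen (reg s x)).+1, s; split=> //.
    + exact: ExecWhileFalse.
    + nia.
    + by apply: bitlen_within_le bs; lia.
  have [t1 [s1 [e1 w1 t1le b1 f1]]] := IH _ _ _ bs w.
  have [t2 [s2 [e2 q2 t2le b2 f2]]] := IHn _ _ b1 w1.
  exists ((bitlen (reg s x)).+1 + t1 + t2), s2; split=> //.
  + exact: ExecWhileTrue e1 e2.
  + move: (weight B c) t1le t2le => W t1le; rewrite [n.+1 * _]mulSn.
    move: (n * W.+1) => V t2le.
    set X := (2 * (b + (W.+1 + V).+1)).+1.
    have h1' : t1 <= W * X by apply: leq_trans t1le _; apply: leq_mul => //; rewrite /X; lia.
    have h2' : t2 <= V.+1 * X by apply: leq_trans t2le _; apply: leq_mul => //; rewrite /X; lia.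
    have -> : (W.+1 + V).+1 * X = X + W * X + V.+1 * X by rewrite /X; nia.
    by move: h1' h2'; rewrite /X; lia.
  + by apply: bitlen_within_le b2; lia.
  + by move=> z hz; rewrite f2 // f1.
Qed.

Lemma wp_mono B c (Q Q' : state -> Prop) s :
  (forall s', Q s' -> Q' s') -> wp B c Q s -> wp B c Q' s.
Proof.
elim: c Q Q' s => [|x v|x y z|x y z|x y|x y|c1 IH1 c2 IH2|x c1 IH1 c2 IH2|x c IH]
  Q Q' s QQ' /=; try exact: QQ'.
- by apply: IH1 => s'; apply: IH2.
- by case: eqP => _; [apply: IH2 | apply: IH1].
- case=> n nB w; exists n => //.
  elim: n s w {nB} => [|n IHn] s /=; case: eqP => // _; try exact: QQ'.
  by apply: IH => s'; apply: IHn.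
Qed.

(** The index of [Inv] counts the iterations still to come, so one invariant gives correctness,
    termination and the iteration bound. *)
Lemma wp_while B x c (Inv : nat -> state -> Prop) (Q : state -> Prop) n s :
  n <= B ->
  (forall s', Inv 0 s' -> reg s' x = 0 /\ Q s') ->
  (forall i s', i < n -> Inv i.+1 s' -> reg s' x <> 0 /\ wp B c (Inv i) s') ->
  Inv n s -> wp B (While x c) Q s.
Proof.
move=> nB h0 hS I /=; exists n => // {nB}.
elim: n s hS I => [|n IHn] s hS I /=.
  by have [-> q] := h0 _ I.
have [/eqP/negbTE -> w] := hS n s (ltnSn n) I.
apply: wp_mono w => s' I'; apply: IHn => // i s'' hi; apply: hS; lia.
Qed.

(** Every loop costs a factor of order [B], and the nesting depth is fixed by the program. *)
Lemma weight_poly c : exists A d, forall B, weight B c <= A * B.+1 ^ d.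
Proof.
have step A d A' d' B : A * B.+1 ^ d + A' * B.+1 ^ d' <= (A + A') * B.+1 ^ (d + d').
  rewrite mulnDl; apply: leq_add; rewrite leq_mul2l leq_pexp2l ?orbT //; lia.
have one B d : 0 < B.+1 ^ d by rewrite expn_gt0.
elim: c => [|x v|x y z|x y z|x y|x y|c1 [A1 [d1 h1]] c2 [A2 [d2 h2]]
  |x c1 [A1 [d1 h1]] c2 [A2 [d2 h2]]|x c [A [d h]]] /=;
  try by exists 1, 0 => B; rewrite expn0.
- by exists (bitlen v).+1, 0 => B; rewrite expn0 muln1.
- exists (A1 + A2), (d1 + d2) => B.
  by apply: leq_trans (leq_add (h1 B) (h2 B)) (step _ _ _ _ _).
- exists (A1 + A2).+1, (d1 + d2) => B.
  have := leq_trans (leq_add (h1 B) (h2 B)) (step _ _ _ _ _).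
  by move: (one B (d1 + d2)); rewrite mulSn; lia.
- exists A.+2, d.+1 => B; move: (h B) (one B d); rewrite expnS.
  by move: (B.+1 ^ d) => X; nia.
Qed.

(** * The reduction program *)

Declare Scope prog_scope.
Local Notation "c1 ;; c2" := (Seq c1 c2) (at level 60, right associativity) : prog_scope.
Local Open Scope prog_scope.

Lemma wp_seq B c1 c2 Q s : wp B (c1 ;; c2) Q s = wp B c1 (wp B c2 Q) s.
Proof. by []. Qed.

Lemma wp_const B x v Q s : wp B (Const x v) Q s = Q (set_reg s x v).
Proof. by []. Qed.

Lemma wp_add B x y z Q s :
  wp B (Add x y z) Q s = Q (set_reg s x (reg s y + reg s z)).
Proof. by []. Qed.

Lemma wp_sub B x y z Q s :
  wp B (Defs.Sub x y z) Q s = Q (set_reg s x (reg s y - reg s z)).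
Proof. by []. Qed.

Lemma wp_get B x y Q s :
  wp B (Get x y) Q s = Q (set_reg s x (Defs.mem s (reg s y))).
Proof. by []. Qed.

Lemma wp_put B x y Q s : wp B (Put x y) Q s = Q (set_mem s (reg s x) (reg s y)).
Proof. by []. Qed.

Lemma wp_if B x c1 c2 Q s : wp B (If x c1 c2) Q s =
  if reg s x == 0 then wp B c2 Q s else wp B c1 Q s.
Proof. by []. Qed.

(* The cases match syntactically: a bare [rewrite !wp_seq] matches up to
   conversion and would unfold subprograms such as [divide]. *)
Ltac wp_step := repeat match goal with
  | |- wp _ (_ ;; _) _ _ => rewrite wp_seq
  | |- wp _ (Const _ _) _ _ => rewrite wp_const
  | |- wp _ (Add _ _ _) _ _ => rewrite wp_add
  | |- wp _ (Defs.Sub _ _ _) _ _ => rewrite wp_sub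
  | |- wp _ (Get _ _) _ _ => rewrite wp_get
  | |- wp _ (Put _ _) _ _ => rewrite wp_put
  end.

Definition upd_only (L : seq nat) (s s' : state) : Prop :=
  forall z, z \notin L -> reg s' z = reg s z.

Lemma upd_only_trans L s1 s2 s3 :
  upd_only L s1 s2 -> upd_only L s2 s3 -> upd_only L s1 s3.
Proof. by move=> h1 h2 z hz; rewrite h2 // h1. Qed.

Ltac frame :=
  let z := fresh "z" in let hz := fresh "hz" in let e := fresh "e" in
  move=> z hz /=;
  repeat (case: eqP => [e|_]; first by rewrite e in hz).

(* Divides r_7 by [d]: the remainder stays in r_7, and r_6 receives the
   quotient multiplied by [a]. *)
Definition divide (d a : nat) : prog :=
  Const 6 0 ;; Const 9 d.-1 ;; Defs.Sub 8 7 9 ;;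
  While 8 (Const 9 d ;; Defs.Sub 7 7 9 ;; Const 9 a ;; Add 6 6 9 ;;
           Const 9 d.-1 ;; Defs.Sub 8 7 9).

Lemma wp_divide B d a Q s :
  0 < d -> reg s 7 <= B ->
  (forall s', Defs.mem s' =1 Defs.mem s -> upd_only [:: 6; 7; 8; 9] s s' ->
    reg s' 7 = reg s 7 %% d -> reg s' 6 = reg s 7 %/ d * a -> Q s') ->
  wp B (divide d a) Q s.
Proof.
move=> d0 vB; set v := reg s 7 => HQ.
rewrite /divide; wp_step; set s0 := (X in wp _ _ _ X).
(* By truncation, register 8 is nonzero exactly when register 7 is at least [d], that is, when
   another subtraction is due. *)
apply: (@wp_while _ _ _ (fun i t =>
   [/\ Defs.mem t =1 Defs.mem s, upd_only [:: 6; 7; 8; 9] s t,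
     reg t 7 = v %% d + i * d, reg t 6 = (v %/ d - i) * a /\ i <= v %/ d &
     reg t 8 = reg t 7 - d.-1]) _ (v %/ d)).
- by apply: leq_trans vB; apply: leq_div.
- move=> t [h1 h2 h3 [h4 _] h5]; have := ltn_pmod v d0.
  split; first by rewrite h5 h3; lia.
  by apply: HQ => //; rewrite ?h3 ?h4; rewrite ?subn0; lia.
- move=> i t iv [h1 h2 h3 [h4 h4'] h5]; have := ltn_pmod v d0 => hm.
  split; first by rewrite h5 h3; nia.
  rewrite /= /set_reg /update /=; split => //=.
  + by frame; apply: h2.
  + by rewrite h3; nia.
  + by rewrite h4; split; [nia | lia].
- rewrite /s0 /set_reg /update /=; split => //=.
  + by frame.
  + by rewrite -/v addnC -divn_eq.
  + by rewrite subnn.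
Qed.

(** Turns a value held in register 7 into a position in the program: the branch [f i] is written
    with [i] known. *)
Fixpoint switch (n : nat) (f : nat -> prog) : prog :=
  if n is n'.+1 then
    If 7 (Const 9 1 ;; Defs.Sub 7 7 9 ;; switch n' (fun i => f i.+1)) (f 0)
  else Skip.

Lemma wp_switch B n f Q s :
  reg s 7 < n ->
  (forall s', Defs.mem s' =1 Defs.mem s -> upd_only [:: 7; 9] s s' ->
     wp B (f (reg s 7)) Q s') ->
  wp B (switch n f) Q s.
Proof.
elim: n f s => [//|n IHn] f s vn HQ /=; case: eqP => [v0|/eqP v0].
  by rewrite v0 in HQ; apply: HQ.
rewrite -lt0n in v0.
apply: IHn; rewrite /set_reg /update /=; first by lia.
move=> s' m' u'; rewrite subn1 prednK //; apply: HQ; first exact: m'.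
by apply: upd_only_trans u'; frame.
Qed.

(* Offsets of the blocks of the literals read so far are kept in the registers
   from 12 on. *)
Definition offset_reg (i : nat) : nat := i.+4.+4.+4.

Section Emit.

Variables (r s k D : nat) (leaf : seq nat -> seq (nat * seq (seq nat))).

(** Horner form of the sum over the literals i of [D ^ i] times the exponent that the i-th vector,
    placed at its offset, gives to variable [a]. The test [o <= a] guards against truncated
    subtraction; behind the block [nth] returns 0. *)
Fixpoint mono (os : seq nat) (vs : seq (seq nat)) (a : nat) : nat :=
  match os, vs with
  | o :: os, v :: vs => (if o <= a then nth 0 v (a - o) else 0) + D * mono os vs a
  | _, _ => 0
  end.

Definition poly_code (N : nat) (os : seq nat) (ts : seq (nat * seq (seq nat))) :
    seq nat :=
  size ts :: flatten [seq t.1 :: mkseq (mono os t.2) N | t <- ts].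

Definition incr_cell (i j e : nat) : prog :=
  Const 8 j ;; Add 8 8 3 ;; Add 8 8 (offset_reg i) ;; Get 9 8 ;;
  Const 10 e ;; Add 9 9 10 ;; Put 8 9.

Fixpoint incr_vec (i c j : nat) (v : seq nat) : prog :=
  if v is e :: v' then incr_cell i j (c * e) ;; incr_vec i c j.+1 v' else Skip.

(** The machine cannot multiply, but [c] is a power of [D] and all products [c * e] are computed
    when the program is written. *)
Fixpoint incr_mono (i c : nat) (vs : seq (seq nat)) : prog :=
  if vs is v :: vs' then incr_vec i c 0 v ;; incr_mono i.+1 (c * D) vs'
  else Skip.

(** Cells from register 3 on are still 0 when a term begins. Hence increments build up the
    exponents, adding where blocks coincide, and skipping [N] cells leaves 0 for variables outside
    the blocks. *)
Definition emit_term (t : nat * seq (seq nat)) : prog :=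
  Const 9 t.1 ;; Put 3 9 ;; Const 9 1 ;; Add 3 3 9 ;;
  incr_mono 0 1 t.2 ;; Add 3 3 2.

Fixpoint emit_terms (ts : seq (nat * seq (seq nat))) : prog :=
  if ts is t :: ts' then emit_term t ;; emit_terms ts' else Skip.

Definition emit_poly (ts : seq (nat * seq (seq nat))) : prog :=
  Const 9 (size ts) ;; Put 3 9 ;; Const 9 1 ;; Add 3 3 9 ;; emit_terms ts.

(** A decision tree: the position in the program records the residues [acc], which select a
    hard-wired table [leaf acc]. Only the block offsets, which grow with the formula, are kept in
    registers. *)
Fixpoint read_clause (fuel : nat) (acc : seq nat) : prog :=
  if fuel is fuel'.+1 then
    If 5 (Const 9 1 ;; Defs.Sub 5 5 9 ;; Get 7 4 ;; Add 4 4 9 ;;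
          divide s.*2 r ;; Const 9 0 ;; Add (offset_reg (size acc)) 6 9 ;;
          switch s.*2 (fun rho => read_clause fuel' (rcons acc rho)))
         (emit_poly (leaf acc))
  else emit_poly (leaf acc).

Definition prelude : prog :=
  Const 9 0 ;; Add 3 0 9 ;; Get 7 9 ;; divide s r ;; Const 9 r ;; Add 2 6 9 ;;
  Put 3 2 ;; Const 9 1 ;; Add 3 3 9 ;; Get 1 9 ;; Put 3 1 ;; Add 3 3 9 ;;
  Const 4 2.

Definition read_clauses : prog :=
  While 1 (Const 9 1 ;; Defs.Sub 1 1 9 ;; Get 5 4 ;; Add 4 4 9 ;;
           read_clause k [::]).

(** The output was written behind the input because clauses were still to be read. It is copied to
    address 0 in increasing order, which is safe for overlapping ranges, and the leftovers in the
    following cells, as many as the input had, are zeroed. *)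
Definition move_down : prog :=
  Defs.Sub 4 3 0 ;; Const 5 0 ;; Add 5 5 4 ;; Const 1 0 ;; Const 6 0 ;;
  Add 6 6 0 ;; Const 9 1 ;;
  While 5 (Get 7 6 ;; Put 1 7 ;; Add 1 1 9 ;; Add 6 6 9 ;; Defs.Sub 5 5 9) ;;
  Const 5 0 ;; Add 5 5 0 ;; Const 7 0 ;;
  While 5 (Put 1 7 ;; Add 1 1 9 ;; Defs.Sub 5 5 9) ;;
  Const 9 0 ;; Add 0 4 9.

Definition reduction : prog := prelude ;; read_clauses ;; move_down.

(** * Verification of the reduction program *)

Lemma wp_incr_vec B i c j v Q st l N g o :
  reg st 3 = size l -> reg st (offset_reg i) = o -> o + (j + size v) <= N ->
  Defs.mem st =1 nth 0 (l ++ mkseq g N) ->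
  (forall st',
     Defs.mem st' =1 nth 0 (l ++ mkseq (fun a =>
       g a + c * (if o + j <= a then nth 0 v (a - (o + j)) else 0)) N) ->
     upd_only [:: 8; 9; 10] st st' -> Q st') ->
  wp B (incr_vec i c j v) Q st.
Proof.
elim: v j st g Q => [|e v IHv] j st g Q h3 ho hN hm HQ.
  apply: HQ => // a; rewrite hm; congr nth; congr cat; apply: eq_mkseq => b.
  by rewrite nth_nil; case: ifP; rewrite muln0 addn0.
rewrite [incr_vec _ _ _ _]/= /incr_cell; wp_step.
rewrite /set_mem /set_reg /update /=; rewrite /= in hN.
apply: (IHv j.+1 _ (fun a => g a + (if a == o + j then c * e else 0))) => //=.
- by lia.
- move=> a; rewrite h3 ho !hm !nth_cat.
  have -> : j + size l + o < size l = false by lia.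
  have -> : j + size l + o - size l = o + j by lia.
  case: eqP => [->|ne].
    have -> : j + size l + o < size l = false by lia.
    have -> : j + size l + o - size l = o + j by lia.
    by rewrite !nth_mkseq ?eqxx; lia.
  case: ltnP => // la; case: (ltnP (a - size l) N) => aN.
    by rewrite !nth_mkseq //; case: eqP => //; lia.
  by rewrite !nth_default ?size_mkseq.
- move=> st' hm' hu'; apply: HQ => [a|].
    rewrite hm'; congr nth; congr cat; apply: eq_mkseq => b.
    rewrite -addnA; congr (_ + _).
    case: (ltngtP b (o + j)) => hb.
    + have -> : o + j.+1 <= b = false by lia.
      by rewrite muln0.
    + have -> : o + j.+1 <= b by lia.
      have -> : b - (o + j) = (b - (o + j.+1)).+1 by lia.
      by [].
    + have -> : o + j.+1 <= b = false by lia.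
      by rewrite muln0 addn0 hb subnn.
  by apply: upd_only_trans hu'; frame.
Qed.

Lemma wp_incr_mono B i c vs Q st l N g os :
  reg st 3 = size l -> (forall j, j < size os -> reg st (offset_reg (i + j)) = nth 0 os j) ->
  size vs = size os -> all (fun v => size v == r) vs -> all (fun o => o + r <= N) os ->
  Defs.mem st =1 nth 0 (l ++ mkseq g N) ->
  (forall st',
     Defs.mem st' =1 nth 0 (l ++ mkseq (fun a => g a + c * mono os vs a) N) ->
     upd_only [:: 8; 9; 10] st st' -> Q st') ->
  wp B (incr_mono i c vs) Q st.
Proof.
elim: vs i c os st g Q => [|v vs IH] i c [|o os] st g Q //= h3 ho sz.
  move=> _ _ hm HQ; apply: HQ => // a; rewrite hm; congr nth; congr cat.
  by apply: eq_mkseq => b; rewrite muln0 addn0.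
move=> /andP [/eqP vr vsr] /andP [oN osN] hm HQ; case: sz => sz.
apply: (@wp_incr_vec B i c 0 v _ st l N g o) => //.
- by have := ho 0; rewrite addn0 => ->.
- by rewrite vr.
move=> st1 hm1 hu1.
have h3' : reg st1 3 = size l by rewrite hu1.
have ho' j : j < size os -> reg st1 (offset_reg (i.+1 + j)) = nth 0 os j.
  by move=> hj; rewrite hu1 // addSnnS ho.
apply: (IH i.+1 (c * D) os st1 _ Q h3' ho' sz vsr osN hm1).
move=> st2 hm2 hu2; apply: HQ; last exact: upd_only_trans hu1 hu2.
move=> a; rewrite hm2; congr nth; congr cat; apply: eq_mkseq => b.
by rewrite -!addnA addn0 mulnDr mulnA.
Qed.

Lemma wp_emit_term B t Q st l N os :
  reg st 2 = N -> reg st 3 = size l ->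
  (forall j, j < size os -> reg st (offset_reg j) = nth 0 os j) ->
  size t.2 = size os -> all (fun v => size v == r) t.2 ->
  all (fun o => o + r <= N) os -> Defs.mem st =1 nth 0 l ->
  (forall st',
     let l' := l ++ t.1 :: mkseq (mono os t.2) N in
     Defs.mem st' =1 nth 0 l' -> reg st' 3 = size l' ->
     upd_only [:: 3; 8; 9; 10] st st' -> Q st') ->
  wp B (emit_term t) Q st.
Proof.
move=> h2 h3 ho sz tr oN hm HQ; rewrite /emit_term; wp_step.
rewrite /set_mem /set_reg /update /=.
apply: (@wp_incr_mono B 0 1 t.2 _ _ (rcons l t.1) N (fun=> 0) os) => //=.
- by rewrite h3 size_rcons addn1.
- move=> a; rewrite h3 nth_cat nth_rcons size_rcons hm.
  case: (ltngtP a (size l)) => hal.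
  + by have -> : a < (size l).+1 by lia.
  + have -> : a < (size l).+1 = false by lia.
    rewrite nth_default; last by lia.
    case: (ltnP (a - (size l).+1) N) => h; first by rewrite nth_mkseq.
    by rewrite nth_default // size_mkseq.
  + by rewrite hal ltnSn.
- move=> st' hm' hu'; apply: HQ.
  + move=> a /=; rewrite hm' cat_rcons; congr nth; congr cat; congr cons.
    by apply: eq_mkseq => b; rewrite mul1n.
  + by rewrite /= /update /= !hu' //= h3 h2 size_cat /= size_mkseq; lia.
  + move=> z hz; rewrite /= /update; case: eqP => [e|_]; first by rewrite e in hz.
    rewrite hu' /=; last by apply: contra hz; rewrite !inE => ->; rewrite orbT.
    by repeat (case: eqP => [e|_]; first by rewrite e in hz).
Qed.

Lemma wp_emit_terms B ts Q st l N os :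
  reg st 2 = N -> reg st 3 = size l ->
  (forall j, j < size os -> reg st (offset_reg j) = nth 0 os j) ->
  all (fun t => (size t.2 == size os) && all (fun v => size v == r) t.2) ts ->
  all (fun o => o + r <= N) os -> Defs.mem st =1 nth 0 l ->
  (forall st',
     let l' := l ++ flatten [seq t.1 :: mkseq (mono os t.2) N | t <- ts] in
     Defs.mem st' =1 nth 0 l' -> reg st' 3 = size l' ->
     upd_only [:: 3; 8; 9; 10] st st' -> Q st') ->
  wp B (emit_terms ts) Q st.
Proof.
elim: ts l st => [|t ts IH] l st h2 h3 ho.
  by move=> _ oN hm HQ; apply: HQ => //=; rewrite cats0.
case/andP=> /andP [/eqP sz tr] tsr oN hm HQ.
rewrite [emit_terms _]/= wp_seq.
apply: (@wp_emit_term B t _ st l N os h2 h3 ho sz tr oN hm).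
move=> st1 l1 hm1 h31 hu1; apply: (IH l1 st1) => //.
- by rewrite hu1.
- by move=> j hj; rewrite hu1 // ho.
move=> st2 l2 hm2 h32 hu2; apply: HQ; last exact: upd_only_trans hu1 hu2.
  by move=> a; rewrite hm2 /l2 /l1 -catA.
by rewrite h32 /l2 /l1 -catA.
Qed.

Lemma wp_emit_poly B ts Q st l N os :
  reg st 2 = N -> reg st 3 = size l ->
  (forall j, j < size os -> reg st (offset_reg j) = nth 0 os j) ->
  all (fun t => (size t.2 == size os) && all (fun v => size v == r) t.2) ts ->
  all (fun o => o + r <= N) os -> Defs.mem st =1 nth 0 l ->
  (forall st',
     let l' := l ++ poly_code N os ts in
     Defs.mem st' =1 nth 0 l' -> reg st' 3 = size l' ->
     upd_only [:: 3; 8; 9; 10] st st' -> Q st') ->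
  wp B (emit_poly ts) Q st.
Proof.
move=> h2 h3 ho tsr oN hm HQ; rewrite /emit_poly; wp_step.
rewrite /set_mem /set_reg /update /=.
apply: (@wp_emit_terms B ts _ _ (rcons l (size ts)) N os) => //=.
- by rewrite h3 size_rcons addn1.
- move=> a; rewrite h3 nth_rcons hm.
  case: (ltngtP a (size l)) => // hal.
  by rewrite nth_default //; lia.
- move=> st' hm' h3' hu'; apply: HQ.
  + by move=> a; rewrite hm' cat_rcons.
  + by rewrite h3' cat_rcons.
  + by apply: upd_only_trans hu'; frame.
Qed.

(** A literal code is twice the variable plus the sign, so its quotient by [2 * s] is the index of
    the block. *)
Definition block_offset (c : nat) : nat := c %/ s.*2 * r.

Hypothesis s_gt0 : 0 < s.
Hypothesis leaf_ok : forall acc, all (fun t =>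
  (size t.2 == size acc) && all (fun v => size v == r) t.2) (leaf acc).

Definition clause_poly (N : nat) (cs : seq nat) : seq nat :=
  poly_code N (map block_offset cs) (leaf [seq c %% s.*2 | c <- cs]).

Lemma wp_read_clause B fuel pre cs Q st l N :
  size cs <= fuel -> all (fun c => c <= B) cs ->
  all (fun c => block_offset c + r <= N) (pre ++ cs) ->
  reg st 2 = N -> reg st 3 = size l -> reg st 5 = size cs ->
  (forall j, j < size pre -> reg st (offset_reg j) = nth 0 (map block_offset pre) j) ->
  Defs.mem st =1 nth 0 l ->
  (forall j, j < size cs -> nth 0 l (reg st 4 + j) = nth 0 cs j) ->
  reg st 4 + size cs <= size l ->
  (forall st',
     let l' := l ++ clause_poly N (pre ++ cs) in
     Defs.mem st' =1 nth 0 l' -> reg st' 3 = size l' ->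
     reg st' 4 = reg st 4 + size cs ->
     (forall z, z <= 2 -> reg st' z = reg st z) -> Q st') ->
  wp B (read_clause fuel [seq c %% s.*2 | c <- pre]) Q st.
Proof.
elim: fuel pre cs Q st => [|fuel IH] pre cs Q st.
  case: cs => // _ _; rewrite cats0 => oN h2 h3 h5 ho hm hc _ HQ.
  apply: (@wp_emit_poly B _ _ st l N (map block_offset pre)) => //.
  - by rewrite size_map.
  - by have := leaf_ok [seq c %% s.*2 | c <- pre]; rewrite !size_map.
  - by rewrite all_map.
  move=> st' l' hm' h3' hu'; apply: HQ => //; first by rewrite hu' ?addn0.
  by move=> z hz; rewrite hu' // !inE; lia.
case: cs => [|c cs] hf hB oN h2 h3 h5 ho hm hc hl HQ.
  rewrite /= h5 /=; rewrite !cats0 in oN HQ.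
  apply: (@wp_emit_poly B _ _ st l N (map block_offset pre)) => //.
  - by rewrite size_map.
  - by have := leaf_ok [seq c %% s.*2 | c <- pre]; rewrite !size_map.
  - by rewrite all_map.
  move=> st' l' hm' h3' hu'; apply: HQ => //; first by rewrite hu' ?addn0.
  by move=> z hz; rewrite hu' // !inE; lia.
rewrite [read_clause _ _]/= wp_if h5 [_ == _]/=; wp_step; rewrite /set_reg /update /=.
have hc0 : Defs.mem st (reg st 4) = c by have := hc 0 isT; rewrite addn0 hm => ->.
move: hB => /= /andP [cB hB].
apply: wp_divide; rewrite /= ?hc0; [by rewrite double_gt0 | exact: cB |].
move=> st1 hm1 hu1 h71 h61; wp_step; rewrite /set_reg /update /=.
apply: wp_switch; rewrite /= h71; first by rewrite ltn_pmod // double_gt0.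
move=> st2 hm2 hu2; rewrite -map_rcons.
have eqs z : z \notin [:: 4; 5; 6; 7; 8; 9; offset_reg (size pre)] -> reg st2 z = reg st z.
  move=> hz; rewrite hu2 /=; last by apply: contra hz; rewrite !inE => /orP [] ->; rewrite ?orbT.
  move: hz; rewrite !inE !negb_or size_map => /and5P [z4 z5 z6 z7 /and3P [z8 z9 zo]].
  rewrite (negbTE zo) (negbTE z9) hu1 /=; last by rewrite !inE !negb_or z6 z7 z8 z9.
  by rewrite /update (negbTE z4) (negbTE z7) (negbTE z5) (negbTE z9).
apply: (IH (rcons pre c) cs) => //.
- by rewrite cat_rcons.
- by rewrite eqs.
- by rewrite eqs.
- by rewrite hu2 //= hu1 //= /update /= h5 subn1.
- move=> j; rewrite size_rcons ltnS map_rcons nth_rcons size_map.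
  case: (ltngtP j (size pre)) => // hj _; last first.
    by rewrite hu2 //= /update /= hj size_map eqxx h61 /update /= addn0.
  rewrite eqs ?ho // !inE /offset_reg !eqSS /=; lia.
- by move=> a; rewrite hm2 hm1 hm.
- by move=> j hj; rewrite hu2 //= hu1 //= /update /= -addnA add1n hc.
- by rewrite hu2 //= hu1 //= /update /=; move: hl => /=; lia.
move=> st' l' hm' h3' h4' h2'; apply: HQ.
- by move=> a; rewrite hm' /l' cat_rcons.
- by rewrite h3' /l' cat_rcons.
- by rewrite h4' hu2 //= hu1 //= /update /=; lia.
- by move=> z hz; rewrite h2' // eqs // !inE /offset_reg; lia.
Qed.

Definition clauses_code (css : seq (seq nat)) : seq nat :=
  flatten [seq size c :: c | c <- css].

Definition polys_code (N : nat) (css : seq (seq nat)) : seq nat :=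
  flatten [seq clause_poly N c | c <- css].

Definition nb_vars (n : nat) : nat := n %/ s * r + r.

Lemma wp_read_clauses B css Q st l N :
  size css <= B -> all (fun cs => size cs <= k) css ->
  all (all (fun c => c <= B)) css ->
  all (all (fun c => block_offset c + r <= N)) css ->
  reg st 1 = size css -> reg st 2 = N -> reg st 3 = size l ->
  Defs.mem st =1 nth 0 l ->
  (forall j, j < size (clauses_code css) ->
    nth 0 l (reg st 4 + j) = nth 0 (clauses_code css) j) ->
  reg st 4 + size (clauses_code css) <= size l ->
  (forall st',
     let l' := l ++ polys_code N css in
     Defs.mem st' =1 nth 0 l' -> reg st' 3 = size l' ->
     reg st' 0 = reg st 0 -> Q st') ->
  wp B read_clauses Q st.
Proof.
move=> szB szk cB cN h1 h2 h3 hm hc hl HQ; rewrite /read_clauses.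
apply: (@wp_while _ _ _ (fun i t => exists css1 css2, [/\ css = css1 ++ css2,
  size css2 = i /\ reg t 1 = i, reg t 2 = N /\ reg t 0 = reg st 0,
  reg t 3 = size (l ++ polys_code N css1) /\
    reg t 4 = reg st 4 + size (clauses_code css1) &
  Defs.mem t =1 nth 0 (l ++ polys_code N css1)]) _ (size css)) => //.
- move=> t [css1 [css2 [e [/size0nil e2 t1] [_ t0] [t3 _] tm]]].
  by split=> //; move: e; rewrite e2 cats0 => e; apply: HQ; rewrite ?e.
- move=> i t _ [css1 [[|c css2] [e [// [e2] t1] [t2 t0] [t3 t4] tm]]].
  split; first by rewrite t1.
  have [ck cB' cN'] : [/\ size c <= k, all (fun c => c <= B) c &
      all (fun c => block_offset c + r <= N) c].
    by move: szk cB cN; rewrite e !all_cat /= => /and3P [_ -> _] /and3P [_ -> _] /and3P [_ -> _].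
  have ec : clauses_code css = clauses_code css1 ++ size c :: c ++ clauses_code css2.
    by rewrite /clauses_code e map_cat flatten_cat.
  have hc' j : j <= size c ->
      Defs.mem t (reg t 4 + j) = nth 0 (size c :: c) j.
    move=> hj; rewrite tm t4 nth_cat -addnA.
    have hj' : size (clauses_code css1) + j < size (clauses_code css).
      by rewrite ec size_cat /= size_cat; lia.
    have -> : reg st 4 + (size (clauses_code css1) + j) < size l by lia.
    rewrite hc // ec nth_cat ltnNge leq_addr /= addKn -cat_cons nth_cat /=.
    by rewrite ltnS hj.
  wp_step; rewrite /set_reg /update /=.
  have m4 : Defs.mem t (reg t 4) = size c by have := hc' 0 isT; rewrite addn0.
  apply: (@wp_read_clause B k [::] c _ _ (l ++ polys_code N css1) N) => //=.
  + move=> j hj; have := hc' j.+1 hj; rewrite tm /= => <-.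
    by congr nth; lia.
  + rewrite t4 size_cat; have : size (clauses_code css) <= size l - reg st 4 by lia.
    by rewrite ec size_cat /= size_cat; lia.
  move=> st' hm' h3' h4' h012; exists (rcons css1 c), css2.
  have ep : l ++ polys_code N (rcons css1 c) =
      (l ++ polys_code N css1) ++ clause_poly N c.
    by rewrite /polys_code map_rcons flatten_rcons catA.
  have := (h012 0 isT, h012 1 isT, h012 2 isT); rewrite /= => -[[r0 r1] r2].
  split => //; rewrite ?ep ?r0 ?r1 ?r2 //=.
  + by rewrite cat_rcons.
  + by rewrite t1 subn1.
  + rewrite h3' h4' t4 /clauses_code map_rcons flatten_rcons.
    by split=> //; rewrite [size (_ ++ _ :: _)]size_cat /=; lia.
- exists [::], css; split=> //; rewrite /polys_code /clauses_code /= ?cats0 //.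
  by rewrite addn0.
Qed.

Lemma wp_move_down B (w w' : seq nat) Q st :
  size w <= B -> size w' <= B ->
  reg st 0 = size w -> reg st 3 = size (w ++ w') ->
  Defs.mem st =1 nth 0 (w ++ w') ->
  (forall st', Defs.mem st' =1 nth 0 w' -> reg st' 0 = size w' -> Q st') ->
  wp B move_down Q st.
Proof.
move=> wB w'B h0 h3 hm HQ; rewrite /move_down; wp_step; set s0 := (X in wp _ _ _ X).
apply: (@wp_while _ _ _ (fun i t => i <= size w' /\ [/\
  Defs.mem t =1 (fun a => if a < size w' - i then nth 0 w' a else nth 0 (w ++ w') a),
  reg t 5 = i, reg t 9 = 1 /\ reg t 1 = size w' - i,
  reg t 6 = size w + (size w' - i) & reg t 0 = size w /\ reg t 4 = size w'])
  _ (size w')) => //.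
- move=> t [_ [tm t5 [t9 t1] _ [t0 t4]]]; split => //.
  wp_step; set s1 := (X in wp _ _ _ X).
  apply: (@wp_while _ _ _ (fun i t => i <= size w /\ [/\
    Defs.mem t =1 (fun a => if a < size w' + (size w - i) then nth 0 w' a
      else nth 0 (w ++ w') a), reg t 5 = i, reg t 9 = 1 /\ reg t 7 = 0,
      reg t 1 = size w' + (size w - i) & reg t 4 = size w']) _ (size w)) => //.
  + move=> u [_ [um u5 _ _ u4]]; split => //.
    wp_step; rewrite /set_reg /update; apply: HQ => //=; last by rewrite u4 addn0.
    move=> a; rewrite um subn0; case: ltnP => // ha.
    by rewrite !nth_default ?size_cat //; lia.
  + move=> i u _ [iw [um u5 [u9 u7] u1 u4]]; split; first by rewrite u5.
    wp_step; rewrite /set_mem /set_reg /update /=.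
    split; first by lia.
    split=> /=; [|by rewrite u5 u9; lia|by []|by rewrite u1 u9; lia|by []].
    move=> a; rewrite um u1 u7; case: eqP => [->|ne].
      have -> : size w' + (size w - i.+1) < size w' + (size w - i) by lia.
      by rewrite nth_default //; lia.
    have -> : (a < size w' + (size w - i)) = (a < size w' + (size w - i.+1)) by lia.
    by [].
  + rewrite /s1 /set_reg /update /=; split=> //; split=> //=.
    * by move=> a; rewrite tm subn0 subnn addn0.
    * by rewrite subnn addn0 t1 subn0.
- move=> i t _ [iw [tm t5 [t9 t1] t6 [t0 t4]]]; split; first by rewrite t5.
  wp_step; rewrite /set_mem /set_reg /update /=.
  split; first by lia.
  split=> /=; [|by rewrite t5 t9; lia| |by rewrite t6 t9; lia|by []]; last first.
    by split=> //; rewrite t1 t9; lia.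
  move=> a; rewrite !tm t1 t6; case: eqP => [->|ne].
    have -> : size w' - i.+1 < size w' - i by lia.
    (* The source cell lies at or above the destination, so it has not been overwritten yet. *)
    have -> : size w + (size w' - i.+1) < size w' - i.+1 = false by lia.
    rewrite nth_cat ltnNge leq_addr /= addKn //.
  have -> : (a < size w' - i) = (a < size w' - i.+1) by lia.
  by [].
- have e : size (w ++ w') - size w = size w' by rewrite size_cat addKn.
  rewrite /s0 /set_reg /update /= h0 h3 e !add0n; split=> //; split=> //=.
  + by move=> a; rewrite subnn ltn0 hm.
  + by rewrite subnn.
  + by rewrite subnn addn0.
Qed.

Definition input_word (n : nat) (css : seq (seq nat)) : seq nat :=
  [:: n, size css & clauses_code css].

Definition output_word (n : nat) (css : seq (seq nat)) : seq nat :=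
  [:: nb_vars n, size css & polys_code (nb_vars n) css].

Lemma block_offset_le n c : c < n.*2 -> block_offset c + r <= nb_vars n.
Proof.
move=> cn; rewrite leq_add2r leq_mul2r; apply/orP; right.
rewrite -!muln2 mulnC divnMA divn2; apply: leq_div2r; lia.
Qed.

Lemma wp_reduction B n css Q :
  let w := input_word n css in let w' := output_word n css in
  n.*2 <= B -> size w <= B -> size css <= B -> size w' <= B ->
  all (fun cs => size cs <= k) css -> all (all (fun c => c < n.*2)) css ->
  (forall st, Defs.mem st =1 nth 0 w' -> reg st 0 = size w' -> Q st) ->
  wp B reduction Q (init_state w).
Proof.
move=> w w' nB wB cB w'B szk cn HQ; rewrite /reduction wp_seq /prelude; wp_step.
set s0 := (X in wp _ _ _ X).
have [r03 r07 r00] : [/\ reg s0 3 = size w, reg s0 7 = n & reg s0 0 = size w].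
  by rewrite /s0 /init_state /set_reg /update /= addn0.
have m0 : Defs.mem s0 = nth 0 w by [].
apply: wp_divide; rewrite ?r07 //; first by lia.
move=> s1 hm1 hu1 h71 h61; wp_step; set s2 := (X in wp _ _ _ X).
have [r13 r10] : reg s1 3 = size w /\ reg s1 0 = size w by rewrite !hu1.
pose l := w ++ [:: nb_vars n; size css].
have m2 : Defs.mem s2 =1 nth 0 l.
  move=> a; rewrite /s2 /set_mem /set_reg /update /= !r13 h61 !hm1 m0 addn1 /= /l.
  rewrite [RHS]nth_cat; case: (ltngtP a (size w).+1) => ha.
  - case: (ltngtP a (size w)) => hb //; last by rewrite hb subnn.
    by have := leq_trans hb ha; rewrite ltnn.
  - have -> : (a == size w) = false by lia.
    have -> : a < size w = false by lia.
    have h2 : 2 <= a - size w by lia.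
    by rewrite (nth_default _ (ltnW (ltnW ha))) (@nth_default _ 0 [:: nb_vars n; size css] _ h2).
  - have -> : a < size w = false by lia.
    by rewrite ha subSnn.
have r2 : [/\ reg s2 1 = size css, reg s2 2 = nb_vars n, reg s2 3 = size l,
    reg s2 4 = 2 & reg s2 0 = size w].
  by rewrite /s2 /set_mem /set_reg /update /= !r13 r10 h61 hm1 m0 size_cat !addn1 addn2.
case: r2 => r21 r22 r23 r24 r20.
apply: (@wp_read_clauses B css _ _ l (nb_vars n)) => //.
- by apply: sub_all cn => cs; apply: sub_all => c; lia.
- by apply: sub_all cn => cs; apply: sub_all => c; apply: block_offset_le.
- by move=> j hj; rewrite r24 /l nth_cat /= ltnS ltnS hj.
- by rewrite r24 /l size_cat /=; lia.
move=> st; rewrite -catA => l' hm h3 h0.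
by apply: (@wp_move_down B w w') => //; rewrite h0.
Qed.

End Emit.

(** * Clauses as polynomials *)

Section Interpolation.

Variables (F : finFieldType) (r : nat).
Local Notation q := #|F|.
Local Open Scope ring_scope.

(** Lagrange interpolation: since nonzero elements satisfy [y ^ (q - 1) = 1], the product over [j]
    is the indicator of the point [a]. *)
Definition interpolant (g : {ffun 'I_r -> F} -> F) : {mpoly F[r]} :=
  \sum_a g a *: \prod_j (1 - ('X_j - (a j)%:MP) ^+ q.-1).

Lemma indicator_eq (x y : F) : 1 - (x - y) ^+ q.-1 = (x == y)%:R.
Proof.
have q1 : (1 < q)%N := finNzRing_gt1 F.
case: eqP => [->|/eqP ne].
  by rewrite subrr expr0n -(subnK q1) addnS /= addn1 subr0.
rewrite -subr_eq0 in ne; apply/eqP; rewrite subr_eq0 eq_sym -subr_eq0; apply/eqP.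
apply: (mulfI ne); rewrite mulrBr mulr1 mulr0 -exprS prednK ?expf_card ?subrr //.
by lia.
Qed.

Lemma interpolant_eval g (x : {ffun 'I_r -> F}) : (interpolant g).@[x] = g x.
Proof.
rewrite /interpolant rmorph_sum /= (bigD1 x) //= [X in _ + X]big1 ?addr0 => [|a ax].
  rewrite mevalZ (big_morph _ (mevalM _) (meval1 _)) big1 ?mulr1 //= => j _.
  by rewrite rmorphB rmorph1 rmorphXn rmorphB /= mevalXU mevalC indicator_eq eqxx.
have [j xj] : exists j, x j != a j.
  by apply/existsP; apply: contraR ax => /existsPn h; apply/eqP/ffunP => j;
     apply/esym/eqP; move: (h j); rewrite negbK.
rewrite mevalZ (big_morph _ (mevalM _) (meval1 _)) (bigD1 j) //=.
rewrite rmorphB rmorph1 rmorphXn rmorphB /=.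
by rewrite mevalXU mevalC indicator_eq (negbTE xj) mul0r mulr0.
Qed.

Lemma msize_mul_le n (p p' : {mpoly F[n]}) d d' :
  (msize p <= d.+1 -> msize p' <= d'.+1 -> msize (p * p')%R <= (d + d').+1)%N.
Proof.
move=> h h'; have [->|nz] := eqVneq p 0; first by rewrite mul0r msize0.
have [->|nz'] := eqVneq p' 0; first by rewrite mulr0 msize0.
rewrite msizeM //; apply: (@leq_trans (d.+1 + d'.+1).-1); last by rewrite addnS.
by rewrite -!subn1 leq_sub2r // leq_add.
Qed.

Lemma msize_exp_le n (p : {mpoly F[n]}) d e :
  (msize p <= d.+1 -> msize (p ^+ e)%R <= (e * d).+1)%N.
Proof.
move=> h; elim: e => [|e IH]; first by rewrite expr0 msize1.
by rewrite exprS mulSn; apply: msize_mul_le.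
Qed.

Lemma interpolant_size g : (msize (interpolant g) <= (r * q.-1).+1)%N.
Proof.
apply: leq_trans (msize_sum _ _ _) _; apply/bigmax_leqP_seq => a _ _.
apply: leq_trans (msizeZ_le _ _) _.
have -> : (r * q.-1 = \sum_(j < r) q.-1)%N by rewrite sum_nat_const card_ord.
apply: (big_ind2 (fun (p : {mpoly F[r]}) d => msize p <= d.+1)%N).
- by rewrite msize1.
- by move=> *; apply: msize_mul_le.
move=> j _; apply: leq_trans (msizeD_le _ _) _.
rewrite msize1 msizeN geq_max ltnS leq0n /= -[X in (_ <= X.+1)%N]muln1.
apply: msize_exp_le; apply: leq_trans (msizeD_le _ _) _.
by rewrite msizeX mdeg1 msizeN msizeC geq_max /=; case: (_ != _).
Qed.

End Interpolation.

(** Stated for any commutative monoid because it serves both degrees, as sums, and values, as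
    products. *)
Lemma big_shift (R : Type) (idx : R) (op : Monoid.com_law idx)
    (G : nat -> nat -> R) (r N o : nat) (v : seq nat) :
  size v = r -> o + r <= N -> (forall i, G i 0 = idx) ->
  \big[op/idx]_(i < N) G i (if o <= i then nth 0 v (i - o) else 0) =
  \big[op/idx]_(j < r) G (o + j) (nth 0 v j).
Proof.
move=> sv oN G0.
rewrite -(big_mkord xpredT (fun i => G i (if o <= i then nth 0 v (i - o) else 0))).
rewrite (@big_cat_nat _ _ _ o) //=; last by lia.
rewrite [X in op X _]big_nat [X in op X _]big1 ?Monoid.mul1m; last first.
  by move=> i /andP [_ io]; rewrite leqNgt io.
rewrite (@big_cat_nat _ _ _ (o + r)) //=; last by lia.
rewrite [X in op _ X]big_nat [X in op _ X]big1 ?Monoid.mulm1; last first.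
  by move=> i /andP [oi iN]; rewrite nth_default ?if_same //; lia.
rewrite -{1}[o]add0n big_addn addKn big_mkord; apply: eq_bigr => j _.
by rewrite leq_addl addnK addnC.
Qed.

(** * Products of polynomials written term by term *)

Section ClausePolynomials.

Variables (F : finFieldType) (r s D : nat).
Variable f : nat -> {mpoly F[r]}.
Local Notation term := ('X_{1..r} * F)%type.
Hypothesis f_lt : forall rho m, m \in msupp (f rho) -> mdeg m < D.
Hypothesis D_power : forall x : F, (x ^+ D = x)%R.

Definition terms (rho : nat) : seq term :=
  [seq (m, (f rho)@_m)%R | m <- msupp (f rho)].

Fixpoint product_terms (acc : seq nat) : seq (seq term) :=
  if acc is rho :: acc' then
    [seq t :: ts | t <- terms rho, ts <- product_terms acc']
  else [:: [::]].

Definition exponents (m : 'X_{1..r}) : seq nat := [seq m i | i <- enum 'I_r].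

Definition vectors (ts : seq term) : seq (seq nat) := [seq exponents t.1 | t <- ts].

Definition coefficient (ts : seq term) : F := (\prod_(t <- ts) t.2)%R.

Definition leaf (acc : seq nat) : seq (nat * seq (seq nat)) :=
  [seq (nat_of_ord (enum_rank (coefficient ts)), vectors ts)
  | ts <- product_terms acc].

Lemma size_exponents m : size (exponents m) = r.
Proof. by rewrite size_map size_enum_ord. Qed.

Lemma nth_exponents m (j : 'I_r) : nth 0 (exponents m) j = m j.
Proof. by rewrite (nth_map j) ?nth_ord_enum // size_enum_ord. Qed.

Lemma exponents_lt rho (t : term) i : t \in terms rho -> nth 0 (exponents t.1) i < D.
Proof.
move=> /mapP [m mf ->] /=; have mD := f_lt mf.
case: (ltnP i r) => ir; last by rewrite nth_default ?size_exponents //; lia.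
rewrite (nth_exponents m (Ordinal ir)).
by apply: leq_ltn_trans mD; rewrite mdegE (bigD1 (Ordinal ir)) //= leq_addr.
Qed.

Lemma size_product_terms acc ts : ts \in product_terms acc -> size ts = size acc.
Proof.
elim: acc ts => [|rho acc IH] ts; first by rewrite inE => /eqP->.
by case/allpairsP => -[t ts'] /= [_ h ->] /=; rewrite IH.
Qed.

Lemma leaf_ok acc : all (fun t =>
  (size t.2 == size acc) && all (fun v => size v == r) t.2) (leaf acc).
Proof.
apply/allP => _ /mapP [ts h ->] /=; rewrite size_map (size_product_terms h) eqxx /=.
by apply/allP => _ /mapP [t _ ->]; rewrite size_exponents.
Qed.

Lemma coefficient_neq0 acc ts : ts \in product_terms acc -> coefficient ts != 0%R.
Proof.
rewrite /coefficient; elim: acc ts => [|rho acc IH] ts.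
  by rewrite inE => /eqP->; rewrite big_nil oner_neq0.
case/allpairsP => -[t ts'] /= [/mapP [m mf ->] h ->].
by rewrite big_cons mulf_neq0 ?IH //= -mcoeff_msupp.
Qed.

Lemma uniq_product_terms acc : uniq (product_terms acc).
Proof.
elim: acc => [//|rho acc IH] /=; apply: allpairs_uniq => //.
  by rewrite map_inj_uniq ?msupp_uniq // => m m' [].
by move=> [t ts] [t' ts'] _ _ /= [-> ->].
Qed.

Local Notation mono := (mono D).

(* The exponents are below [D], so they are the base-[D] digits of [mono]:
   no two terms of the product get the same monomial, even when several
   literals share a block. *)
Lemma mono_inj N acc os ts ts' :
  size os = size acc -> all (fun o => o + r <= N) os ->
  ts \in product_terms acc -> ts' \in product_terms acc ->
  (forall i, i < N -> mono os (vectors ts) i = mono os (vectors ts') i) ->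
  ts = ts'.
Proof.
elim: acc os ts ts' => [|rho acc IH] [|o os] ts ts' //.
  by move=> _ _; rewrite !inE => /eqP-> /eqP->.
move=> [sz] /andP [oN osN] /allpairsP [[t u] /= [tr uP ->]].
move=> /allpairsP [[t' u'] /= [tr' uP' ->]] /= h.
have digit (t0 : term) i : t0 \in terms rho ->
    (if o <= i then nth 0 (exponents t0.1) (i - o) else 0) < D.
  move=> ht; have := exponents_lt (i - o) ht.
  by case: ifP => // _; apply: leq_trans.
have D0 : 0 < D by apply: leq_trans (digit t 0 tr).
congr cons.
  have: t.1 = t'.1.
    apply/mnmP => j; have jN : o + j < N by move: (ltn_ord j); lia.
    have := congr1 (modn^~ D) (h _ jN).
    rewrite -(modnDmr _ (_ * mono _ _ _)) -[in RHS](modnDmr _ (_ * mono _ _ _)).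
    rewrite !modnMr !addn0 !modn_small ?digit //.
    by rewrite leq_addr addKn !nth_exponents.
  by move: tr tr' => /mapP [m _ ->] /mapP [m' _ ->] /= ->.
apply: (IH os) => // i iN; have := congr1 (divn^~ D) (h i iN).
rewrite ![_ + D * _]addnC ![D * _]mulnC !divnMDl //.
by rewrite !divn_small ?digit // !addn0.
Qed.

Definition clause_term (N : nat) (os : seq nat) (ts : seq term) : 'X_{1..N} * F :=
  ([multinom mono os (vectors ts) i | i < N], coefficient ts).

Definition clause_terms (N : nat) (os acc : seq nat) : seq ('X_{1..N} * F) :=
  [seq clause_term N os ts | ts <- product_terms acc].

Definition poly_of (N : nat) (l : seq ('X_{1..N} * F)) : {mpoly F[N]} :=
  (\sum_(t <- l) t.2 *: 'X_[t.1])%R.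

Lemma poly_code_clause N os acc :
  poly_code D N os (leaf acc) =
  let l := clause_terms N os acc in size l :: flatten (map (@term_code F N) l).
Proof.
rewrite /poly_code /clause_terms /leaf /= !size_map -!map_comp; congr (_ :: flatten _).
apply: eq_map => ts /=; rewrite /term_code /=; congr cons.
rewrite /mkseq -val_enum_ord -map_comp; apply: eq_map => i /=.
by rewrite mnmE.
Qed.

(** With distinct monomials nothing can cancel or merge, so the support is exactly what is
    listed. *)
Lemma lists_poly_of N (l : seq ('X_{1..N} * F)) :
  uniq (map fst l) -> all (fun t => t.2 != 0%R) l -> lists_poly l (poly_of l).
Proof.
move=> ul nz.
have coef t : t \in l -> ((poly_of l)@_t.1 = t.2)%R.
  move=> tl; rewrite /poly_of raddf_sum /= (bigD1_seq t) ?(map_uniq ul) //=.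
  rewrite mcoeffZ mcoeffX eqxx mulr1 big_seq_cond big1 ?addr0 // => u /andP [ul' ut].
  rewrite mcoeffZ mcoeffX; case: eqP => [e|]; last by rewrite mulr0.
  (* A different term with the same monomial would sit at another index, against
     [uniq (map fst l)]. *)
  have [x0 _] : exists x0 : 'X_{1..N} * F, x0 \in l by exists t.
  have := nth_uniq x0.1; move: ut; rewrite -(nth_index x0 tl) -(nth_index x0 ul') => ut.
  have /eqP := e; rewrite -(nth_index x0 tl) -(nth_index x0 ul') -!(nth_map x0 x0.1) ?index_mem //.
  by rewrite nth_uniq ?size_map ?index_mem // => /eqP e'; rewrite e' eqxx in ut.
have supp m : (m \in msupp (poly_of l)) = (m \in map fst l).
  apply/idP/idP => [|/mapP [t tl ->]]; last first.
    by rewrite mcoeff_msupp coef //; apply: (allP nz).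
  rewrite mcoeff_msupp; apply: contraR => ml.
  rewrite /poly_of raddf_sum /= big_seq big1 // => t tl.
  rewrite mcoeffZ mcoeffX; case: eqP => [e|]; last by rewrite mulr0.
  by rewrite -e map_f in ml.
apply: uniq_perm; first exact: map_uniq ul.
  by rewrite map_inj_uniq ?msupp_uniq // => m m' [].
move=> [m c]; apply/idP/mapP => [h|[m' m'l [-> ->]]].
  by exists m; rewrite ?supp ?(coef _ h) //; apply: (map_f fst h).
by move: m'l; rewrite supp => /mapP [t tl ->]; rewrite coef // -surjective_pairing.
Qed.

Lemma clause_lists N os acc :
  size os = size acc -> all (fun o => o + r <= N) os ->
  lists_poly (clause_terms N os acc) (poly_of (clause_terms N os acc)).
Proof.
move=> sz oN; apply: lists_poly_of; last first.
  by apply/allP => _ /mapP [ts h ->]; apply: coefficient_neq0 h.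
rewrite -map_comp map_inj_in_uniq ?uniq_product_terms // => ts ts' h h' /= /mnmP e.
apply: (mono_inj sz oN h h') => i iN.
by have := e (Ordinal iN); rewrite !mnmE.
Qed.

(** This is [E * (1 + D + ... + D ^ (n - 1))]: the factor number i has degree at most [E],
    multiplied by [D ^ i]. *)
Definition degree_bound (E n : nat) : nat := iter n (fun x => E + D * x) 0.

Lemma clause_size N E os acc :
  (forall rho m, m \in msupp (f rho) -> mdeg m <= E) ->
  size os = size acc -> all (fun o => o + r <= N) os ->
  msize (poly_of (clause_terms N os acc)) <= (degree_bound E (size acc)).+1.
Proof.
move=> fE sz oN; apply: leq_trans (msize_sum _ _ _) _.
apply/bigmax_leqP_seq => _ /mapP [ts h ->] _ /=.
apply: leq_trans (msizeZ_le _ _) _; rewrite msizeX ltnS mdegE.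
under eq_bigr => i _ do rewrite mnmE.
elim: acc os ts sz oN h => [|rho acc IH] [|o os] ts //.
  by move=> _ _; rewrite inE => /eqP->; rewrite big1.
move=> [sz] /andP [oN osN] /allpairsP [[t u] /= [tr uP ->]] /=.
rewrite big_split /= -big_distrr leq_add ?leq_mul2l ?IH ?orbT //.
rewrite (@big_shift _ _ _ (fun _ e => e) r) ?size_exponents //.
under eq_bigr => j _ do rewrite nth_exponents.
by case/mapP: tr => m mf ->; rewrite -mdegE; apply: fE mf.
Qed.

(** Only values agree, not polynomials: a Horner step gives [y ^ (e + D * m) = y ^ e * (y ^ D) ^ m],
    and [y ^ D = y]. *)
Lemma clause_eval N os acc (y : nat -> F) :
  size os = size acc -> all (fun o => o + r <= N) os ->
  ((poly_of (clause_terms N os acc)).@[fun i : 'I_N => y i] =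
   \prod_(p <- zip os acc) (f p.2).@[fun j : 'I_r => y (p.1 + j)%N])%R.
Proof.
move=> sz oN; rewrite /poly_of rmorph_sum /= big_map.
under eq_bigr => ts _ do rewrite mevalZ mevalX /=.
under eq_bigr => ts _ do under eq_bigr => i _ do rewrite mnmE.
elim: acc os sz oN => [|rho acc IH] [|o os] //=.
  move=> _ _; rewrite big_seq1 big_nil /coefficient big_nil mul1r.
  by rewrite big1 // => i _; rewrite expr0.
move=> [sz] /andP [oN osN]; rewrite big_cons -(IH os) //= big_allpairs_dep mulr_suml.
rewrite big_map; apply: eq_big_seq => m mf; rewrite mulr_sumr; apply: eq_bigr => ts _.
rewrite /coefficient big_cons /= -!mulrA; congr (_ * _)%R.
rewrite mulrCA; congr (_ * _)%R.
under eq_bigr => i _ do rewrite exprD exprM D_power.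
rewrite big_split /=; congr (_ * _)%R.
rewrite (@big_shift _ _ _ (fun i e => (y i ^+ e)%R) r) ?size_exponents //.
by apply: eq_bigr => j _; rewrite nth_exponents.
Qed.

End ClausePolynomials.

(** * Blocks of bits as tuples of field elements *)

Section Decoding.

Variables (F : finFieldType) (r s : nat).
Hypothesis s_le : 2 ^ s <= #|F| ^ r.

(** Matches the two types by rank; tuples of rank [2 ^ s] or more go to the all-false block. *)
Definition decode (x : {ffun 'I_r -> F}) : {ffun 'I_s -> bool} :=
  nth [ffun=> false] (enum {ffun 'I_s -> bool}) (enum_rank x).

Definition bit (x : {ffun 'I_r -> F}) (i : nat) : bool :=
  if insub i is Some j then decode x j else false.

Lemma bit_surj (b : nat -> bool) : exists x, forall i, i < s -> bit x i = b i.
Proof.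
pose g := [ffun i : 'I_s => b i].
have lt : enum_rank g < #|{ffun 'I_r -> F}|.
  apply: leq_trans (ltn_ord _) _.
  by rewrite !card_ffun !card_ord card_bool.
exists (enum_val (Ordinal lt)) => i hi.
by rewrite /bit insubT /= /decode enum_valK /= nth_enum_rank ffunE.
Qed.

End Decoding.

(** * Equivalence of the formula and the system *)

Section Correctness.

Variables (F : finFieldType) (r s D k : nat).
Hypotheses (s_le : 2 ^ s <= #|F| ^ r) (s_gt0 : 0 < s) (r_gt0 : 0 < r).
Hypotheses (D_power : forall x : F, (x ^+ D = x)%R) (D_gt : r * #|F|.-1 < D).

(* [rho] is a literal code modulo [2 * s]: its position in the block, doubled,
   plus its sign. *)
Definition falsity (rho : nat) : {mpoly F[r]} :=
  interpolant (fun x => (bit s x rho./2 != odd rho)%:R)%R.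

Lemma falsity_mdeg rho m : m \in msupp (falsity rho) -> mdeg m <= r * #|F|.-1.
Proof. by move=> /msize_mdeg_lt h; have := leq_trans h (interpolant_size _). Qed.

Lemma falsity_lt rho m : m \in msupp (falsity rho) -> mdeg m < D.
Proof. by move=> /falsity_mdeg h; apply: leq_ltn_trans h D_gt. Qed.

Local Notation offset := (block_offset r s).

Lemma literal_code_lt n (l : literal n) : literal_code l < n.*2.
Proof.
case: l => v b; rewrite /literal_code /= -ltn_half_double addnC.
by rewrite half_bit_double.
Qed.

Lemma literal_mod v (b : bool) : (v.*2 + b) %% s.*2 = (v %% s).*2 + b.
Proof.
rewrite {1}(divn_eq v s) doubleD doubleMr -addnA modnMDl modn_small //.
by have := ltn_pmod v s_gt0; case: b; lia.
Qed.

Lemma literal_div v (b : bool) : (v.*2 + b) %/ s.*2 = v %/ s.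
Proof.
by rewrite -[s.*2]mul2n divnMA -muln2 divnMDl // (divn_small (d := 2)) ?addn0 //; case: b.
Qed.

Lemma falsity_eval v (b : bool) (y : 'I_r -> F) :
  ((falsity ((v %% s).*2 + b)).@[y] = (bit s [ffun j => y j] (v %% s) != b)%:R)%R.
Proof.
set x := [ffun j => y j].
have -> : ((falsity ((v %% s).*2 + b)).@[y] = (falsity ((v %% s).*2 + b)).@[x])%R.
  by apply: meval_eq => j; rewrite ffunE.
rewrite /falsity interpolant_eval; congr ((bit s x _ != _)%:R)%R.
  by rewrite addnC half_bit_double.
by rewrite oddD odd_double; case: b.
Qed.

Definition cnf_poly (n : nat) (c : seq nat) : {mpoly F[nb_vars r s n]} :=
  poly_of (clause_terms D falsity (nb_vars r s n) (map offset c)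
    [seq a %% s.*2 | a <- c]).

(** A product of values 0 and 1 is a conjunction. The empty clause yields the constant 1, an
    unsolvable equation, as it should. *)
Lemma cnf_poly_eval n (c : seq (literal n)) (y : nat -> F) :
  ((cnf_poly n (map (@literal_code n) c)).@[fun i => y i] =
   (all (fun l : literal n =>
      bit s [ffun j : 'I_r => y (l.1 %/ s * r + j)%N] (l.1 %% s) != l.2) c)%:R)%R.
Proof.
rewrite /cnf_poly (clause_eval falsity D_power) ?size_map //; last first.
  apply/allP => _ /mapP [_ /mapP [l _ ->] ->]; apply: block_offset_le => //.
  exact: literal_code_lt.
elim: c => [|l c IH] /=; first by rewrite big_nil.
rewrite big_cons {}IH /= -mulnb natrM; congr (_ * _)%R.
rewrite {1}/literal_code literal_mod falsity_eval.
congr ((bit s _ _ != _)%:R)%R; apply/ffunP => j; rewrite !ffunE.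
by rewrite /block_offset /literal_code literal_div.
Qed.

Definition cnf_system_polys (n : nat) (css : seq (seq nat)) :
    seq {mpoly F[nb_vars r s n]} := [seq cnf_poly n c | c <- css].

Lemma degree_bound_le m n : m <= n ->
  degree_bound D (r * #|F|.-1) m <= degree_bound D (r * #|F|.-1) n.
Proof.
have D0 : 0 < D by apply: leq_ltn_trans D_gt.
move=> /subnK <-; rewrite addnC; elim: (n - m) => [|i IH]; first by rewrite addn0.
rewrite addnS; apply: leq_trans IH _.
by apply: leq_trans (leq_pmull _ D0) (leq_addl _ _).
Qed.

(** The successor makes the degree positive for every [k]. *)
Definition degree : nat := (degree_bound D (r * #|F|.-1) k).+1.

Lemma offsets_ok n c : all (fun a => a < n.*2) c ->
  all (fun o => o + r <= nb_vars r s n) (map offset c).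
Proof.
by move=> h; rewrite all_map; apply: sub_all h => a; apply: block_offset_le.
Qed.

Lemma cnf_poly_size n c : size c <= k -> all (fun a => a < n.*2) c ->
  msize (cnf_poly n c) <= degree.+1.
Proof.
move=> ck cn; have sz : size (map offset c) = size [seq a %% s.*2 | a <- c].
  by rewrite !size_map.
apply: leq_trans (clause_size D falsity_mdeg sz (offsets_ok cn)) _.
by rewrite size_map ltnS; apply: leqW; apply: degree_bound_le.
Qed.

Definition cnf_system n (css : seq (seq nat))
    (h : all (fun c => (size c <= k) && all (fun a => a < n.*2) c) css) :
  polysys F degree.
Proof.
refine (@PolySys F degree (nb_vars r s n) (cnf_system_polys n css) _).
by move=> _ /mapP [c cc ->]; have /andP [ck cn] := allP h c cc; apply: cnf_poly_size.
Defined.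

Lemma cnf_system_encodes n css h :
  polysys_encodes (@cnf_system n css h) (output_word r s D (leaf falsity) n css).
Proof.
exists [seq clause_terms D falsity (nb_vars r s n) (map offset c)
  [seq a %% s.*2 | a <- c] | c <- css]; split.
  rewrite /= /cnf_system_polys; elim: css h => [//|c css IH] /= /andP [/andP [_ cn] h].
  rewrite IH // andbT; apply: clause_lists => //; first exact: falsity_lt.
    by rewrite !size_map.
  exact: offsets_ok.
rewrite /= /output_word size_map; congr [:: _, _ & flatten _].
by rewrite -map_comp; apply: eq_map => c; rewrite /clause_poly poly_code_clause.
Qed.

Lemma cnf_system_zero n (cs : seq (seq (literal n))) h :
  has_common_zero (@cnf_system n [seq map (@literal_code n) c | c <- cs] h) <->
  exists a : 'I_n -> bool,
    forall c, c \in cs -> exists2 l : literal n, l \in c & a l.1 = l.2.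
Proof.
have zero (y : nat -> F) (c : seq (literal n)) :
    ((cnf_poly n (map (@literal_code n) c)).@[fun i => y i] = 0)%R <->
    exists2 l : literal n, l \in c &
      bit s [ffun j : 'I_r => y (l.1 %/ s * r + j)] (l.1 %% s) = l.2.
  rewrite cnf_poly_eval; split.
    case: allP => [_ /eqP|]; first by rewrite oner_eq0.
    move=> /allP /allPn [l lc /negPn /eqP e] _; by exists l.
  by case=> l lc e; case: allP => // /(_ l lc); rewrite e eqxx.
split=> [[x hx]|[a ha]].
  pose y i := if insub i is Some j then x j else 0%R.
  exists (fun v => bit s [ffun j : 'I_r => y (v %/ s * r + j)] (v %% s)) => c cc.
  apply/zero; rewrite -[RHS](hx (cnf_poly n (map (@literal_code n) c))).
    apply: meval_eq => j; rewrite /y insubT //= => h'; congr x; exact: val_inj.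
  by rewrite /= /cnf_system_polys; do 2!apply: map_f.
(* Padding the assignment by false fills the last, possibly incomplete block. *)
pose b i := if insub i is Some j then a j else false.
have hb beta := bit_surj s_le (fun i => b (beta * s + i)).
(* In boolean form, so that [xchoose] picks a preimage for every block. *)
have hb' beta : exists x : {ffun 'I_r -> F}, [forall i : 'I_s, bit s x i == b (beta * s + i)].
  by have [x hx] := hb beta; exists x; apply/forallP => i; rewrite hx.
pose z beta := xchoose (hb' beta).
have hz beta i : i < s -> bit s (z beta) i = b (beta * s + i).
  by move=> hi; have /forallP /(_ (Ordinal hi)) /eqP := xchooseP (hb' beta).
pose y t := z (t %/ r) (Ordinal (ltn_pmod t r_gt0)).
exists (fun i => y i) => _ /mapP [_ /mapP [c cc ->] ->].
apply/zero; have [l lc e] := ha c cc; exists l => //.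
have -> : [ffun j : 'I_r => y (l.1 %/ s * r + j)] = z (l.1 %/ s).
  apply/ffunP => j; rewrite ffunE /y divnMDl // (divn_small (ltn_ord j)) addn0.
  by congr (z _ _); apply: val_inj; rewrite /= modnMDl modn_small.
rewrite hz ?ltn_pmod // -divn_eq /b; case: insubP => [u _ eu|]; last by rewrite ltn_ord.
by rewrite -e; congr a; apply: val_inj.
Qed.

End Correctness.

(** * Running time of the reduction *)

Definition poly_bounded (g : nat -> nat) : Prop :=
  exists A d, forall n, g n <= A * n.+1 ^ d.

Lemma poly_bounded_le g g' :
  (forall n, g n <= g' n) -> poly_bounded g' -> poly_bounded g.
Proof. by move=> le [A [d h]]; exists A, d => n; apply: leq_trans (le n) (h n). Qed.

Lemma poly_bounded_const c : poly_bounded (fun=> c).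
Proof. by exists c, 0 => n; rewrite muln1. Qed.

Lemma poly_bounded_id : poly_bounded id.
Proof. by exists 1, 1 => n; rewrite mul1n expn1. Qed.

Lemma poly_bounded_mul g g' :
  poly_bounded g -> poly_bounded g' -> poly_bounded (fun n => g n * g' n).
Proof.
move=> [A [d h]] [A' [d' h']]; exists (A * A'), (d + d') => n.
by rewrite expnD mulnACA leq_mul.
Qed.

Lemma poly_bounded_add g g' :
  poly_bounded g -> poly_bounded g' -> poly_bounded (fun n => g n + g' n).
Proof.
move=> [A [d h]] [A' [d' h']]; exists (A + A'), (d + d') => n.
rewrite mulnDl; apply: leq_add.
  by apply: leq_trans (h n) _; rewrite leq_mul2l leq_pexp2l ?leq_addr ?orbT.
by apply: leq_trans (h' n) _; rewrite leq_mul2l leq_pexp2l ?leq_addl ?orbT.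
Qed.

Lemma poly_bounded_exp g e : poly_bounded g -> poly_bounded (fun n => g n ^ e).
Proof.
move=> h; elim: e => [|e IH]; first exact: (poly_bounded_const 1).
by apply: (@poly_bounded_le _ (fun n => g n * g n ^ e)) (poly_bounded_mul h IH) => n;
   rewrite expnS.
Qed.

Lemma poly_bounded_S g : poly_bounded g -> poly_bounded (fun n => (g n).+1).
Proof.
by move=> h; apply: (@poly_bounded_le _ (fun n => g n + 1)) => [n|];
   [rewrite addn1 | apply: poly_bounded_add h (poly_bounded_const 1)].
Qed.

Lemma poly_bounded_double g : poly_bounded g -> poly_bounded (fun n => (g n).*2).
Proof.
by move=> h; apply: (@poly_bounded_le _ (fun n => g n + g n)) => [n|];
   [rewrite addnn | apply: poly_bounded_add].
Qed.

Create HintDb poly_bounded.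
#[local] Hint Resolve poly_bounded_const poly_bounded_id poly_bounded_mul
  poly_bounded_add poly_bounded_exp poly_bounded_S poly_bounded_double
  : poly_bounded.

(** Register 0 is spared: it passes the length of the output on to the next program. *)
Fixpoint clear_regs (R : nat) : prog :=
  if R is R'.+1 then Const R 0 ;; clear_regs R' else Skip.

Lemma wp_clear_regs B R Q st :
  (forall st', Defs.mem st' = Defs.mem st -> reg st' 0 = reg st 0 ->
     (forall z, 0 < z <= R -> reg st' z = 0) ->
     (forall z, R < z -> reg st' z = reg st z) -> Q st') ->
  wp B (clear_regs R) Q st.
Proof.
elim: R Q st => [|R IH] Q st HQ /=; first by apply: HQ => // z; lia.
apply: IH => st' m' r0 rz rR; apply: HQ; rewrite ?m' ?r0 // => z hz.
  case: (eqVneq z R.+1) => [->|ne]; last by apply: rz; lia.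
  by rewrite rR //= /update eqxx.
by rewrite rR /=; [rewrite /update; case: eqP => // ?; lia | lia].
Qed.

Lemma reg_bound_clear R : reg_bound (clear_regs R) <= R.+1.
Proof. by elim: R => //= R IH; rewrite geq_max ltnS leqnn /=; lia. Qed.

Lemma input_size_le b (w : seq nat) : (forall a, bitlen (nth 0 w a) <= b) ->
  input_size w <= size w * b.+1.
Proof.
move=> h; rewrite /input_size sumnE big_map (big_nth 0) big_mkord.
apply: leq_trans (leq_sum _ (E2 := fun=> b.+1) _) _ => [i _|].
  by rewrite ltnS h.
by rewrite sum_nat_const card_ord.
Qed.

(** [exec] composes only through equal states, while the analysis of the program yields pointwise
    agreement. *)
Lemma state_eq st st' : reg st =1 reg st' -> Defs.mem st =1 Defs.mem st' -> st = st'.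
Proof.
by case: st st' => [r m] [r' m'] /= h h';
   rewrite (functional_extensionality _ _ h) (functional_extensionality _ _ h').
Qed.

Section Sizes.

Variables (r s k D M : nat) (leaf : seq nat -> seq (nat * seq (seq nat))).
Hypothesis leaf_size : forall acc, size acc <= k -> all (fun rho => rho < s.*2) acc ->
  size (leaf acc) <= M.
Hypothesis s_gt0 : 0 < s.

Lemma size_clauses_code css : all (fun c => size c <= k) css ->
  size (clauses_code css) <= size css * k.+1.
Proof.
elim: css => [//|c css IH] /= /andP [hc h].
by rewrite size_cat mulSn addSn ltnS leq_add // IH.
Qed.

Lemma size_poly_code N os ts : size (poly_code D N os ts) = (size ts * N.+1).+1.
Proof.
rewrite /poly_code /=; congr _.+1; elim: ts => [//|t ts IH] /=.
by rewrite size_cat IH size_mkseq mulSn.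
Qed.

Lemma size_polys_code N css : all (fun c => size c <= k) css ->
  size (polys_code r s D leaf N css) <= size css * (M * N.+1).+1.
Proof.
elim: css => [//|c css IH] /andP [hc h].
have -> : polys_code r s D leaf N (c :: css) =
  clause_poly r s D leaf N c ++ polys_code r s D leaf N css by [].
rewrite size_cat [size (_ :: _)]/= mulSn leq_add ?IH // size_poly_code ltnS.
rewrite leq_mul2r leaf_size ?orbT //.
  by rewrite size_map.
by apply/allP => _ /mapP [a _ ->]; rewrite ltn_pmod // double_gt0.
Qed.

Lemma nb_vars_le n : nb_vars r s n <= r * n.+1.
Proof. by rewrite /nb_vars mulnS addnC leq_add2l mulnC leq_mul2l leq_div orbT. Qed.

(* Bounds the number of iterations of every loop of the reduction. *)
Definition loop_bound (n : nat) : nat :=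
  let m := n.*2.+1 ^ k in
  n.*2 + (m * k.+1).+2 + (m * (M * (r * n.+1).+1).+1).+2.

Lemma poly_bounded_loop_bound : poly_bounded loop_bound.
Proof.
by rewrite /loop_bound; auto 20 with poly_bounded.
Qed.

(** The crude estimate [bitlen a <= a] suffices, since all numbers in sight are polynomial in
    [n]. *)
Lemma init_bounded n css : all (fun c => size c <= k) css ->
  all (all (fun c => c < n.*2)) css ->
  bitlen_within (n.*2 + size (input_word n css) + k + size css) (init_state (input_word n css)).
Proof.
move=> szk cn; set w := input_word n css; set b := _ + size css.
have hw a : a \in w -> a <= b.
  rewrite !inE => /or3P [/eqP->|/eqP->|]; [rewrite /b; lia | rewrite /b; lia |].
  case/flattenP => _ /mapP [c cc ->]; rewrite inE => /orP [/eqP->|ac].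
    by have := allP szk c cc; rewrite /b; lia.
  by have := allP (allP cn c cc) a ac; rewrite /b; lia.
have wb : size w <= b by rewrite /b; lia.
split=> a; apply: leq_trans (bitlen_leq _) _; rewrite /init_state [X in X <= _]/=.
  by rewrite /update; case: eqP.
case: (ltnP a (size w)) => ha; first exact/hw/mem_nth.
by rewrite nth_default.
Qed.

Lemma reduction_runs : (forall acc, all (fun t =>
    (size t.2 == size acc) && all (fun v => size v == r) t.2) (leaf acc)) ->
  exists P A d, forall n css,
    all (fun c => (size c <= k) && all (fun a => a < n.*2) c) css ->
    size css <= n.*2.+1 ^ k ->
    exists t, [/\ exec P (init_state (input_word n css)) t
                     (init_state (output_word r s D leaf n css)),
                t <= A * n.+1 ^ d &
                input_size (output_word r s D leaf n css) <= A * n.+1 ^ d].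
Proof.
move=> leaf_ok; pose R := reduction r s k D leaf.
pose P := R ;; clear_regs (reg_bound R).
have [A1 [d1 hW]] := weight_poly P.
(* [W] bounds the weight and [b] the initial word length. The first summand of [T] is the resulting
   time; the second bounds the output, at most [loop_bound n] cells of at most [b n + W n] bits. *)
pose W n := A1 * (loop_bound n).+1 ^ d1.
pose b n := loop_bound n + k + loop_bound n.
pose T n := W n * (2 * (b n + W n)).+1 + loop_bound n * (b n + W n).+1.
have [A [d hA]] : poly_bounded T.
  have hl := poly_bounded_loop_bound.
  by rewrite /T /W /b; auto 20 with poly_bounded.
exists P, A, d => n css h hm.
have szk : all (fun c => size c <= k) css by apply: sub_all h => c /andP [].
have cn : all (all (fun c => c < n.*2)) css by apply: sub_all h => c /andP [].
set w := input_word n css; set w' := output_word r s D leaf n css.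
have wB : n.*2 + size w + size w' <= loop_bound n.
  have h1 : size w <= (n.*2.+1 ^ k * k.+1).+2.
    by rewrite /w /= !ltnS (leq_trans (size_clauses_code szk)) // leq_mul2r hm orbT.
  have h2 : size w' <= (n.*2.+1 ^ k * (M * (r * n.+1).+1).+1).+2.
    rewrite /w' /= !ltnS (leq_trans (size_polys_code _ szk)) //.
    by rewrite leq_mul // ltnS leq_mul2l ltnS nb_vars_le orbT.
  by rewrite /loop_bound /= -addnA -addnA leq_add2l leq_add.
have cB : size css <= size w.
  rewrite /w /= -addn2; apply: leq_trans (leq_addr 2 _).
  elim: (css) => [//|c l IH] /=; rewrite ltnS size_cat.
  exact: leq_trans IH (leq_addl _ _).
have bs : bitlen_within (b n) (init_state w).
  by apply: bitlen_within_le (init_bounded szk cn); rewrite /b -/w; lia.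
pose Q st := [/\ Defs.mem st =1 nth 0 w', reg st 0 = size w' &
  forall z, 0 < z <= reg_bound R -> reg st z = 0].
have : wp (loop_bound n) P Q (init_state w).
  apply: wp_reduction => //; try by move: wB cB; rewrite -/w -/w'; lia.
  move=> st hm' h0; apply: wp_clear_regs => st' m' r0 rz _.
  by split=> // [a|]; rewrite ?m' ?r0.
move=> /(wp_sound bs) [t [st [e [hm' h0 hz] ht bst fr]]].
have Wle : weight (loop_bound n) P <= W n := hW _.
have stE : st = init_state w'.
  apply: state_eq => // z; rewrite /init_state /= /update.
  case: eqP => [->//|z0]; case: (leqP z (reg_bound R)) => hzR; first by apply: hz; lia.
  rewrite fr; last by rewrite geq_max (ltnW hzR) (leq_trans (reg_bound_clear _)).
  by rewrite /= /update; case: eqP.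
exists t; rewrite -stE; split => //; apply: leq_trans (hA n); rewrite /T.
  apply: leq_trans ht _; apply: leq_trans (leq_addr _ _).
  by rewrite leq_mul // ltnS leq_mul2l leq_add2l Wle.
apply: leq_trans (leq_addl _ _).
apply: leq_trans (@input_size_le (b n + W n) _ _) _; last first.
  by rewrite leq_mul2r; apply/orP; right; move: wB; lia.
by move=> a; rewrite -hm'; apply: leq_trans (bst.2 a) _; rewrite leq_add2l.
Qed.

End Sizes.

(** A set of at most [k] elements is listed by a [k]-tuple padded with [None], whence the
    successor. *)
Lemma card_small_sets (T : finType) (k : nat) (A : {set {set T}}) :
  (forall C, C \in A -> #|C| <= k) -> #|A| <= #|T|.+1 ^ k.
Proof.
move=> Ak; rewrite -card_option -card_tuple -cardsT.
pose g (t : k.-tuple (option T)) := [set x | Some x \in t].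
apply: leq_trans (leq_imset_card g _); apply/subset_leq_card/subsetP => C CA.
have sz : size (map Some (enum C) ++ nseq (k - #|C|) None) == k.
  by rewrite size_cat size_map -cardE size_nseq subnKC ?Ak.
apply/imsetP; exists (Tuple sz) => //; apply/setP => x.
rewrite inE /= memtE /= mem_cat mem_map ?mem_enum; last by move=> ? ? [].
by rewrite mem_nseq andbF orbF.
Qed.

Lemma kcnf_encodes_clauses k (f : kcnf k) w :
  kcnf_encodes f w -> exists cs : seq (seq (literal (kcnf_vars f))),
    let css := [seq map (@literal_code _) c | c <- cs] in
    [/\ w = input_word (kcnf_vars f) css,
        all (fun c => (size c <= k) && all (fun a => a < (kcnf_vars f).*2) c) css,
        size css <= (kcnf_vars f).*2.+1 ^ k &
        satisfiable f <-> exists a : 'I_(kcnf_vars f) -> bool,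
          forall c, c \in cs -> exists2 l : literal _, l \in c & a l.1 = l.2].
Proof.
case=> cs [ucs pe ew]; exists cs => css.
have clause c : c \in cs -> [set l in c] \in kcnf_clauses f.
  by move=> cc; rewrite -mem_enum -(perm_mem pe) map_f.
split.
- rewrite ew /input_word /css size_map /clauses_code -map_comp; congr [:: _, _ & flatten _].
  by apply: eq_map => c /=; rewrite size_map.
- apply/allP => _ /mapP [c cc ->]; rewrite size_map; apply/andP; split.
    have /card_uniqP <- := allP ucs c cc; rewrite -cardsE.
    by apply: (@kcnf_width k f); apply: clause.
  by apply/allP => _ /mapP [l _ ->]; apply: literal_code_lt.
- have -> : size css = #|kcnf_clauses f|.
    by rewrite cardE -(perm_size pe) !size_map.
  apply: leq_trans (card_small_sets (@kcnf_width k f)) _.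
  by rewrite card_prod card_ord card_bool muln2.
- split=> -[a ha]; exists a.
    by move=> c cc; have [l lc e] := ha _ (clause c cc); exists l; rewrite // inE in lc.
  move=> C; rewrite -mem_enum -(perm_mem pe) => /mapP [c cc ->].
  by have [l lc e] := ha c cc; exists l; rewrite ?inE.
Qed.

(** A power of q, so that [x ^ D = x], and larger than [r * q] because [m < q ^ m]. *)
Definition digit_base (q r : nat) : nat := q ^ (r * q).

Definition pes_degree (q r k : nat) : nat :=
  (degree_bound (digit_base q r) (r * q.-1) k).+1.

Lemma kSAT_to_PES (F : finFieldType) (r s k : nat) :
  2 ^ s <= #|F| ^ r -> 0 < s -> 0 < r ->
  exists P A d, forall (f : kcnf k) w, kcnf_encodes f w ->
  exists (S : polysys F (pes_degree #|F| r k)) w' t, [/\ polysys_encodes S w',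
    ps_vars S = nb_vars r s (kcnf_vars f),
    has_common_zero S <-> satisfiable f,
    exec P (init_state w) t (init_state w') &
    t <= A * (kcnf_vars f).+1 ^ d /\ input_size w' <= A * (kcnf_vars f).+1 ^ d].
Proof.
move=> s_le s0 r0; set q := #|F|; set D := digit_base q r.
have q1 : 1 < q := finNzRing_gt1 F.
have D_gt : r * q.-1 < D.
  by apply: leq_trans (ltn_expl (r * q) q1); rewrite ltnS leq_mul2l leq_pred orbT.
have D_power (x : F) : (x ^+ D = x)%R.
  rewrite /D /digit_base; elim: (r * q) => [|i IH]; first by rewrite expn0 expr1.
  by rewrite expnSr exprM IH expf_card.
pose lf := leaf (@falsity F r s).
(* The successor makes [M] positive, so that clauses shorter than [k] also have at most [M ^ k]
   terms. *)
pose M := (\sum_(rho < s.*2) size (terms (@falsity F r s) rho)).+1.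
have leaf_size acc : size acc <= k -> all (fun rho => rho < s.*2) acc ->
    size (lf acc) <= M ^ k.
  move=> hk hacc; rewrite /lf /leaf size_map.
  apply: leq_trans (_ : M ^ size acc <= _); last exact: leq_pexp2l.
  elim: acc hacc {hk} => [//|rho acc IH] /= /andP [hr hacc].
  rewrite size_allpairs expnS leq_mul ?IH //.
  by rewrite /M (bigD1 (Ordinal hr)) //= leqW // leq_addr.
have [P [A [d hP]]] := reduction_runs D leaf_size s0 (@leaf_ok _ _ _).
exists P, A, d => f w /kcnf_encodes_clauses [cs [-> hcs szcs sat]].
have [t [ex tle isz]] := hP _ _ hcs szcs.
set css := [seq _ | c <- cs] in hcs szcs ex tle isz *.
exists (cnf_system s0 D_gt hcs), (output_word r s D lf (kcnf_vars f) css), t.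
split; [|by []| |exact: ex|by []].
  exact: cnf_system_encodes.
by apply: iff_trans (iff_sym sat); apply: cnf_system_zero.
Qed.

(** * Estimates for the exponents *)

Local Open Scope R_scope.

Lemma INR_leq m n : (m <= n)%N -> INR m <= INR n.
Proof. by move=> h; apply: le_INR; apply/leP. Qed.

Lemma INR_expn m n : INR (m ^ n)%N = INR m ^ n.
Proof. by elim: n => [//|n IH]; rewrite expnS mult_INR IH. Qed.

Lemma ln_ge0 x : 1 <= x -> 0 <= ln x.
Proof.
move=> h; case: (Rle_lt_or_eq_dec _ _ h) => [h'|<-]; last by rewrite ln_1; lra.
by rewrite -ln_1; left; apply: ln_increasing; lra.
Qed.

Lemma exp_le_compat x y : x <= y -> exp x <= exp y.
Proof. by case=> [h|->]; [left; apply: exp_increasing | right]. Qed.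

Lemma ln_le_compat x y : 0 < x -> x <= y -> ln x <= ln y.
Proof. by move=> x0 [h|->]; [left; apply: ln_increasing | right]. Qed.

Lemma Rpower_ge1 b x : 1 <= b -> 0 <= x -> 1 <= Rpower b x.
Proof.
move=> hb hx; rewrite /Rpower -exp_0.
have := Rmult_le_pos _ _ hx (ln_ge0 hb).
by case=> [h|<-]; [left; apply: exp_increasing | right].
Qed.

Lemma pow_le_Rpower (d : nat) (eta : R) : 0 < eta ->
  exists2 C, 0 < C & forall n : nat, INR n.+1 ^ d <= C * Rpower 2 (eta * INR n).
Proof.
move=> eta0; have l2 : 0 < ln 2 by rewrite -ln_1; apply: ln_increasing; lra.
(* Chosen so that [exp (u * n)] is the root of order [d + 1] of [2 ^ (eta * n)]; it then remains to
   compare [c * (n + 1)] with [1 + u * n], which [c = min (1, u)] allows. *)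
pose u := eta * ln 2 / INR d.+1.
have d0 : 0 < INR d.+1 by apply: lt_0_INR; apply/ltP.
have u0 : 0 < u by apply: Rdiv_lt_0_compat => //; apply: Rmult_lt_0_compat.
pose c := Rmin 1 u.
have c0 : 0 < c by apply: Rmin_glb_lt; lra.
exists (/ c ^ d.+1); first by apply/Rinv_0_lt_compat/pow_lt.
move=> n; have n0 := pos_INR n.
have h1 : c * INR n.+1 <= exp (u * INR n).
  apply: Rle_trans (exp_ineq1_le _); rewrite S_INR.
  have := Rmin_l 1 u; have := Rmin_r 1 u; rewrite -/c => h2 h3.
  have := Rmult_le_compat_r _ _ _ n0 h2; lra.
have e : Rpower 2 (eta * INR n) = exp (u * INR n) ^ d.+1.
  rewrite /Rpower -[exp (u * _)]/(exp (u * INR n)) -Rpower_pow; last exact: exp_pos.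
  rewrite /Rpower ln_exp; congr exp; rewrite /u; field; lra.
rewrite e; apply: (Rle_trans _ (INR n.+1 ^ d.+1)).
  by apply: Rle_pow; [rewrite S_INR; lra | apply/leP].
apply: (Rmult_le_reg_l (c ^ d.+1)); first exact: pow_lt.
rewrite -Rpow_mult_distr -Rmult_assoc Rinv_r ?Rmult_1_l; last first.
  by apply: Rgt_not_eq; apply: pow_lt.
by apply: pow_incr; split=> //; apply: Rmult_le_pos; [lra | apply: pos_INR].
Qed.

(* The packing loss: [s] bits fit in [r] field elements while
   [q ^ r < 2 ^ s.+1], and [n %/ s <= n / r <= delta / 2 * n]. *)
Lemma packing_exponent (q r s n : nat) (delta delta' : R) :
  (1 < q)%N -> (q ^ r <= 2 ^ s.+1)%N -> (0 < s)%N -> (r <= s)%N ->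
  0 < delta' <= 1 / 2 -> delta' <= delta -> 2 <= delta' * INR r ->
  Rpower (INR q) ((1 - delta) * INR (nb_vars r s n)) <=
  Rpower 2 ((1 - delta' / 2) * INR n + INR s.+1).
Proof.
move=> q1 qr s0 rs [d0 d1] dd hr.
have q1' : 1 < INR q by apply: (lt_INR 1); apply/ltP.
have lq : 0 <= ln (INR q) by apply: ln_ge0; lra.
have l2 : 0 < ln 2 by rewrite -ln_1; apply: ln_increasing; lra.
rewrite /Rpower; apply: exp_le_compat.
set N := nb_vars r s n; have N0 := pos_INR N.
have h1 : INR r * ln (INR q) <= INR s.+1 * ln 2.
  rewrite -!ln_pow; [|lra|lra]; apply: ln_le_compat; first by apply: pow_lt; lra.
  have -> : 2 ^ s.+1 = INR (2 ^ s.+1)%N by rewrite INR_expn.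
  by rewrite -INR_expn; apply: INR_leq.
pose u := (n %/ s)%N; have u0 := pos_INR u.
have eN : INR N = (INR u + 1) * INR r.
  by rewrite /N /nb_vars plus_INR mult_INR -/u; ring.
have us : INR u * INR s <= INR n.
  by rewrite -mult_INR; apply: INR_leq; apply: leq_divM.
have rs' : INR r <= INR s by apply: INR_leq.
have ud : INR u <= delta' / 2 * INR n.
  have a1 : INR u * INR r <= INR n.
    by apply: Rle_trans us; apply: Rmult_le_compat_l.
  have a2 : INR u * 2 <= INR u * (delta' * INR r) by apply: Rmult_le_compat_l.
  have a3 := Rmult_le_compat_l delta' _ _ (Rlt_le _ _ d0) a1; lra.
have h2 : INR N * ln (INR q) <= (INR u + 1) * INR s.+1 * ln 2.
  by rewrite eN !Rmult_assoc; apply: Rmult_le_compat_l; lra.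
have h3 : (INR u + 1) * INR s.+1 <= (1 + delta' / 2) * INR n + INR s.+1.
  rewrite S_INR; lra.
(* [1 - delta] may be negative; [1 - delta'] is at least 1/2, so inequalities can be multiplied by
   it. *)
apply: (Rle_trans _ ((1 - delta') * (INR N * ln (INR q)))).
  rewrite Rmult_assoc; apply: Rmult_le_compat_r; last lra.
  exact: Rmult_le_pos.
apply: (Rle_trans _ ((1 - delta') * (((1 + delta' / 2) * INR n + INR s.+1) * ln 2))).
  apply: Rmult_le_compat_l; first lra.
  by apply: Rle_trans h2 _; apply: Rmult_le_compat_r; lra.
rewrite -Rmult_assoc; apply: Rmult_le_compat_r; first lra.
(* The product [(1 - delta') * (1 + delta' / 2)] is at most [1 - delta' / 2]. *)
have n0 := pos_INR n; have s1 := pos_INR s.+1; nra.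
Qed.

(* [P1] bounds the running time of the reduction and the size of its output,
   [X] is the exponential part of the running time on that output. *)
Lemma combine_bounds (K P1 X Y Z : R) (e : nat) (t1 t2 size : nat) :
  INR t1 <= P1 -> INR size <= P1 -> 1 <= P1 -> 0 <= X -> X <= Y -> 1 <= Y ->
  P1 ^ e.+1 <= Z ->
  INR t2 <= K * X * INR size ^ e ->
  INR (t1 + t2) <= (1 + Rabs K) * (Z * Y).
Proof.
move=> h1 hs P1ge X0 XY Y1 hZ h2; rewrite plus_INR Rmult_plus_distr_r Rmult_1_l.
have hpe : P1 ^ e <= P1 ^ e.+1 by apply: Rle_pow => //; apply/leP.
have hp1 : P1 <= P1 ^ e.+1.
  by rewrite -{1}[P1]pow_1; apply: Rle_pow => //; apply/leP.
have hse : INR size ^ e <= Z.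
  by apply: Rle_trans hZ; apply: Rle_trans hpe; apply: pow_incr; split=> //; apply: pos_INR.
have se0 : 0 <= INR size ^ e by apply: pow_le; apply: pos_INR.
apply: Rplus_le_compat.
  apply: (Rle_trans _ (Z * 1)); first by rewrite Rmult_1_r; lra.
  by apply: Rmult_le_compat_l; lra.
apply: Rle_trans h2 _.
apply: (Rle_trans _ (Rabs K * X * INR size ^ e)).
  apply: Rmult_le_compat_r => //; apply: Rmult_le_compat_r => //; exact: Rle_abs.
rewrite Rmult_assoc; apply: Rmult_le_compat_l; first exact: Rabs_pos.
by rewrite Rmult_comm; apply: Rmult_le_compat.
Qed.

Close Scope R_scope.

Theorem theorem1p2 (hSETH : SETH) (q : nat) (hq : prime_power q)
    (delta : Q) (hdelta : Qlt 0 delta) :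
  exists d : nat, (0 < d)%N /\
    forall F : finFieldType, #|F| = q ->
      ~ solvable_in_Ostar_exp (PES F d) (INR q) (1 - Q2R delta)%real.
Proof.
have q1 : 1 < q.
  case: hq => p [e [pp e0 ->]]; apply: leq_trans (prime_gt1 pp) _.
  by rewrite -{1}(expn1 p) leq_pexp2l // prime_gt0.
have delta0 : (0 < Q2R delta)%real by rewrite -RMicromega.Q2R_0; apply: Qlt_Rlt.
pose delta' := Rmin (Q2R delta) (1 / 2)%real.
have [d0 d1] : (0 < delta' <= 1 / 2)%real.
  by split; [apply: Rmin_glb_lt; lra | apply: Rmin_r].
have dd : (delta' <= Q2R delta)%real by apply: Rmin_l.
have [r hr] : exists r, (2 <= delta' * INR r)%real.
  by have [r hr] := INR_archimed _ 2%real d0; exists r; lra.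
have r0 : 0 < r by case: r hr => // /=; lra.
pose s := trunc_log 2 (q ^ r).
have qr0 : 0 < q ^ r by rewrite expn_gt0 (ltnW q1).
have /andP [s_le s_lt] : 2 ^ s <= q ^ r < 2 ^ s.+1 by apply: trunc_log_bounds.
have rs : r <= s by apply: trunc_log_max => //; rewrite leq_exp2r.
have s0 : 0 < s by apply: leq_trans rs.
(* Packing keeps a saving of [delta' / 2]; one half of it pays for polynomial factors, the other
   contradicts SETH. *)
have eps0 : (0 < delta' / 4)%real by lra.
have [k _ hard] := hSETH _ eps0.
(* The degree depends on q but not on [F], so it serves every field with q elements. *)
exists (pes_degree q r k); split=> // F hF [c [K [e hsol]]]; apply: hard; subst q.
have [P [A [a hP]]] := @kSAT_to_PES F r s k s_le s0 r0.
(* The time of the reduction and the factor [size ^ e] of the solver are both at most the power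
   [e + 1] of a bound of order [(n + 1) ^ a]. *)
have [C C0 hC] := pow_le_Rpower (a * e.+1) eps0.
exists (Seq P c), ((1 + Rabs K) * (INR A.+1 ^ e.+1 * C * Rpower 2 (INR s.+1)))%real.
move=> f w enc; set n := kcnf_vars f.
have [S [w' [t1 [encS nS zS ex [t1le szle]]]]] := hP f w enc.
have [t2 [st [ex2 yes2 t2le]]] := hsol S w' encS.
exists (t1 + t2), st; split; [exact: ExecSeq ex ex2 | exact: iff_trans yes2 zS |].
pose P1 := (INR A.+1 * INR n.+1 ^ a)%real.
have hP1 t : t <= A * n.+1 ^ a -> (INR t <= P1)%real.
  move=> h; rewrite /P1 -INR_expn -mult_INR; apply: INR_leq.
  exact: leq_trans h (leq_mul (leqnSn A) (leqnn _)).
have P1ge : (1 <= P1)%real.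
  rewrite /P1 -INR_expn -mult_INR; apply: (@INR_leq 1).
  by change (0 < A.+1 * n.+1 ^ a); rewrite muln_gt0 expn_gt0.
have n0 := pos_INR n; have ss0 := pos_INR s.+1.
have hX := @packing_exponent _ r s n _ delta' q1 (ltnW s_lt) s0 rs (conj d0 d1) dd hr.
have hZ : (P1 ^ e.+1 <= INR A.+1 ^ e.+1 * C * Rpower 2 (delta' / 4 * INR n))%real.
  rewrite /P1 Rpow_mult_distr Rmult_assoc; apply: Rmult_le_compat_l.
    by apply: pow_le; apply: pos_INR.
  by rewrite -pow_mult; exact: hC.
have Y1 : (1 <= Rpower 2 ((1 - delta' / 2) * INR n + INR s.+1))%real.
  apply: Rpower_ge1; first lra.
  by apply: Rplus_le_le_0_compat => //; apply: Rmult_le_pos => //; lra.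
rewrite /= in t2le; rewrite nS in t2le.
have := combine_bounds (hP1 _ t1le) (hP1 _ szle) P1ge
  (Rlt_le _ _ (exp_pos _)) hX Y1 hZ t2le.
move=> h; apply: Rle_trans h _; right.
have E : (Rpower 2 (delta' / 4 * INR n) *
    Rpower 2 ((1 - delta' / 2) * INR n + INR s.+1) =
    Rpower 2 (INR s.+1) * Rpower 2 ((1 - delta' / 4) * INR n))%real.
  by rewrite -!Rpower_plus; congr Rpower; lra.
by rewrite [X in (_ * X)%real = _]Rmult_assoc E !Rmult_assoc.
Qed.
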